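(* Let $G$ be a polycyclic-by-finite group and let $A$ be a finite-dimensional vector space over a field $K$. Let $\Sigma \subset A^G$ be a strongly irreducible linear subshift and let $\tau \colon \Sigma \to \Sigma$ be a linear cellular automaton. Then the limit set $\Omega(\tau) = \bigcap_{n \geq 1} \tau^n(\Sigma)$ is the largest (with respect to inclusion) strongly irreducible linear subshift $\Lambda \subset A^G$ contained in $\Sigma$ such that $\tau(\Lambda) \subset \Lambda$ and $\tau|_{\Lambda} \colon \Lambda \to \Lambda$ is pre-injective. (That is, $\Omega(\tau)$ itself has these properties, and it contains every $\Lambda$ having them.)
   Context: A group $G$ is polycyclic if it admits a finite sequence of subgroups $G = G_0 \supset G_1 \supset \cdots \supset G_n = \{1_G\}$ such that $G_{i+1}$ is normal in $G_i$ and $G_i/G_{i+1}$ is a (possibly infinite) cyclic group for all $i$; it is polycyclic-by-finite if it admits a polycyclic subgroup of finite index. $A^G$ is the $K$-vector space of all maps $x \colon G \to A$, equipped with the prodiscrete topology (product topology with each factor $A$ discrete) and with the shift action $(gx)(h) = x(g^{-1}h)$. A linear subshift of $A^G$ is a closed $G$-invariant vector subspace of $A^G$. A subshift $\Sigma \subset A^G$ is strongly irreducible if there exists a finite subset $\Delta \subset G$ such that for all $x, y \in \Sigma$ and all finite subsets $E, F \subset G$ with $E \cap F\Delta = \varnothing$, there exists $z \in \Sigma$ with $z|_E = x|_E$ and $z|_F = y|_F$. A linear cellular automaton $A^G \to A^G$ is a map $\tilde\tau$ for which there exist a finite subset $M \subset G$ and a $K$-linear map $\mu \colon A^M \to A$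 with $\tilde\tau(x)(g) = \mu((g^{-1}x)|_M)$ for all $x \in A^G$, $g \in G$. A linear cellular automaton between linear subshifts $\Sigma_1 \to \Sigma_2$ of $A^G$ is a map that is the restriction of a linear cellular automaton $A^G \to A^G$. A cellular automaton $\tau \colon \Sigma_1 \to \Sigma_2$ is pre-injective if whenever $x, y \in \Sigma_1$ coincide outside a finite subset of $G$ and $\tau(x) = \tau(y)$, then $x = y$. *)

(* Defs.v *)
From HB Require Import structures.
From mathcomp Require Import all_boot all_order all_algebra finmap.
From mathcomp Require Import all_classical topology.

Set Implicit Arguments.
Unset Strict Implicit.
Unset Printing Implicit Defensive.

Import GRing.Theory.

Local Open Scope classical_set_scope.
Local Open Scope ring_scope.

Section PolycyclicByFinite.
Variable G : groupType.

Definition is_subgroup (H : set G) : Prop :=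
  [/\ H 1%g,
      forall x y, H x -> H y -> H (x * y)%g
    & forall x, H x -> H x^-1%g].

Definition is_normal_in (N H : set G) : Prop :=
  N `<=` H /\ forall h x, H h -> N x -> N (h * x * h^-1)%g.

Definition left_coset (H : set G) (g : G) : set G := [set (g * h)%g | h in H].

Definition expgz (g : G) (n : int) : G :=
  match n with Posz k => (g ^+ k)%g | Negz k => (g ^- k.+1)%g end.

(* H / N is cyclic, its elements being the cosets x N with x in H: there is a
   generator g N, i.e. every x N equals (g N)^n = g^n N for some integer n. *)
Definition cyclic_quotient (H N : set G) : Prop :=
  exists2 g : G, H g &
    forall x, H x -> exists n : int, left_coset N x = left_coset N (expgz g n).

Definition polycyclic (H : set G) : Prop :=
  exists (n : nat) (S : nat -> set G),
    [/\ S 0%N = H,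
        S n = [set 1%g],
        forall i, (i <= n)%N -> is_subgroup (S i)
      & forall i, (i < n)%N ->
          is_normal_in (S i.+1) (S i) /\ cyclic_quotient (S i) (S i.+1)].

Definition finite_index (H : set G) : Prop := finite_set (range (left_coset H)).

Definition polycyclic_by_finite : Prop :=
  exists H : set G, [/\ is_subgroup H, polycyclic H & finite_index H].

End PolycyclicByFinite.

Section LinearSubshifts.
Variables (K : fieldType) (A : vectType K) (G : groupType).
Implicit Types (Sigma : set (G -> A)) (tau : (G -> A) -> (G -> A)).

Definition shift (g : G) (x : G -> A) : G -> A := fun h => x (g^-1 * h)%g.

Definition prodiscrete_closed Sigma : Prop :=
  closed (Sigma : set {ptws G -> discrete_topology A}).

Definition shift_invariant Sigma : Prop :=
  forall g x, Sigma x -> Sigma (shift g x).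

Definition vector_subspace Sigma : Prop :=
  [/\ Sigma 0,
      forall x y, Sigma x -> Sigma y -> Sigma (x + y)
    & forall (a : K) x, Sigma x -> Sigma (a *: x)].

Definition linear_subshift Sigma : Prop :=
  [/\ prodiscrete_closed Sigma, shift_invariant Sigma & vector_subspace Sigma].

Definition strongly_irreducible Sigma : Prop :=
  exists D : {fset G}, forall x y, Sigma x -> Sigma y ->
    forall E F : {fset G},
      (E `&` [fset (f * d)%g | f in F, d in D])%fset = fset0 ->
      exists z, [/\ Sigma z, {in E, z =1 x} & {in F, z =1 y}].

Definition full_linear_CA tau : Prop :=
  exists (M : {fset G}) (mu : {linear (M -> A) -> A}),
    forall x g, tau x g = mu (fun m : M => shift g^-1 x (val m)).

(* A map Sigma1 -> Sigma2 is encoded by a total function on A^G sending Sigma1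
   into Sigma2; its values outside Sigma1 are irrelevant. *)
Definition linear_CA Sigma1 Sigma2 tau : Prop :=
  set_fun Sigma1 Sigma2 tau /\
  exists2 T, full_linear_CA T & forall x, Sigma1 x -> tau x = T x.

Definition pre_injective Sigma tau : Prop :=
  forall x y, Sigma x -> Sigma y ->
    (exists F : {fset G}, forall g, g \notin F -> x g = y g) ->
    tau x = tau y -> x = y.

Definition limit_set Sigma tau : set (G -> A) :=
  \bigcap_(n in [set n | (1 <= n)%N]) (iter n tau @` Sigma).

End LinearSubshifts.

(* Main.v *)
Require Import Defs.
From HB Require Import structures.
From mathcomp Require Import all_boot all_order all_algebra finmap.
From mathcomp Require Import all_classical topology.

(* A polycyclic-by-finite group has a finite-index subgroup H that is
   poly-(infinite cyclic).  By the Hilbert basis argument (Hall's theorem)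
   both the finitely supported configurations and the linear functionals on
   A^G depending on finitely many coordinates are Noetherian K[H]-modules.

   A linear subshift is the common kernel of its annihilator among those
   functionals, and extending functionals by Zorn's lemma shows that the image
   of a linear subshift under a linear cellular automaton T is the common
   kernel of the n with n o T in the annihilator.  The sequence T^k(Sigma) is
   therefore dual to an ascending chain and stabilizes at the limit set, on
   which T is surjective.

   The Garden of Eden theorem replaces amenability by the following fact about
   a Noetherian module M over K[H], which has no zero divisors because H is
   left-orderable: if Phi is an injective endomorphism of M, then a K[H]-linear
   map f : M -> K[H] vanishing on Phi(M) vanishes, since otherwise f(m) <> 0
   would make the sum of the Phi^i(K[H] m) direct.  Applied to functionals
   modulo the annihilator it shows that surjective automata are pre-injective;
   applied to the finitely supported configurations, which are dense by strong
   irreducibility, it shows that pre-injective automata are surjective. *)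

Set Implicit Arguments.
Unset Strict Implicit.
Unset Printing Implicit Defensive.

Import GRing.Theory.
Local Open Scope classical_set_scope.

(** * Poly-(infinite cyclic) groups and their left orderings *)

Section PolyZ.
Variable G : groupType.
Local Open Scope group_scope.
Implicit Types (N H P : set G) (g x y u : G).

(** Integer powers with two natural exponents: inversion just swaps [a] and [b]. *)
Definition zpowers g : set G := [set u | exists a b, u = g ^+ a * g ^- b].

(** An equivalence, so that conjugation by [g] maps [N] onto itself; for infinite [N] one inclusion
    would not pass to [g^-1]. *)
Definition normalized N g := forall x, N (x ^ g) <-> N x.

Definition cyclic_extension N g : set G :=
  [set x | exists n u, [/\ N n, zpowers g u & x = n * u]].

(** The last premise gives [g] infinite order modulo [N], so every quotient is infinite cyclic; this
    is what makes the group orderable. *)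
Inductive poly_Z : set G -> Prop :=
| poly_Z_trivial : poly_Z [set 1]
| poly_Z_extension N g : poly_Z N -> normalized N g ->
    (forall k, ~ N (g ^+ k.+1)) -> poly_Z (cyclic_extension N g).

Definition index_finite_in H N :=
  exists s : seq G, forall x, H x -> exists c h, [/\ c \in s, N h & x = c * h].

(** Generation is expressed through the subgroups containing [s], so a property that defines a
    subgroup need only be tested on [s]. *)
Definition finitely_generated H :=
  exists s : seq G, (forall x, x \in s -> H x) /\
    forall P, is_subgroup P -> (forall x, x \in s -> P x) -> H `<=` P.

Lemma commXV g a b : g ^+ a * g ^- b = g ^- b * g ^+ a.
Proof.
have : commute (g ^+ a) (g ^- b) by apply/commuteV/commuteX2.
by [].
Qed.

Lemma zpowersX g k : zpowers g (g ^+ k).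
Proof. by exists k, 0; rewrite expg0 invg1 mulg1. Qed.

Lemma zpowers1 g : zpowers g 1.
Proof. exact: (zpowersX g 0). Qed.

Lemma zpowersV g u : zpowers g u -> zpowers g u^-1.
Proof. by case=> a [b ->]; exists b, a; rewrite invgM invgK. Qed.

Lemma zpowersM g u v : zpowers g u -> zpowers g v -> zpowers g (u * v).
Proof.
move=> [a [b ->]] [c [d ->]]; exists (a + c)%N, (d + b)%N.
rewrite !expgnDr invgM !mulgA -(mulgA (g ^+ a)) -(mulgA (g ^+ a)).
by rewrite -commXV !mulgA -[RHS]mulgA -[X in _ = _ * X]invgM -expgnDr addnC
  expgnDr invgM !mulgA.
Qed.

Lemma zpowersP g u : zpowers g u ->
  u = 1 \/ exists k, u = g ^+ k.+1 \/ u = g ^- k.+1.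
Proof.
move=> [a [b ->]]; case: (ltngtP a b) => [ab|ba|->]; last by left; rewrite mulgV.
- right; exists (b - a).-1; right; rewrite prednK ?subn_gt0 // expgnFr 1?ltnW //.
  by rewrite invgM invgK.
- right; exists (a - b).-1; left; rewrite prednK ?subn_gt0 // expgnFr 1?ltnW //.
Qed.

Lemma zpowers_expgz g (z : int) : zpowers g (expgz g z).
Proof.
case: z => k /=; first exact: zpowersX.
by apply: zpowersV; exact: zpowersX.
Qed.

Lemma zpowers_sub H g : is_subgroup H -> H g -> zpowers g `<=` H.
Proof.
case=> H1 HM HV Hg.
have HX k : H (g ^+ k) by elim: k => [|k IH] //; rewrite expgS; exact: HM.
by move=> _ [a [b ->]]; apply: HM => //; exact: HV.
Qed.

Lemma normalizedX N g k : normalized N g -> normalized N (g ^+ k).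
Proof.
move=> nN x; elim: k x => [|k IH] x; first by rewrite expg0 conjg1.
by rewrite expgS conjgM IH.
Qed.

Lemma normalizedV N g : normalized N g -> normalized N g^-1.
Proof. by move=> nN x; rewrite -(nN (x ^ g^-1)) conjgKV. Qed.

Lemma normalized_zpowers N g u : normalized N g -> zpowers g u -> normalized N u.
Proof.
move=> nN [a [b ->]] x; rewrite conjgM; split.
  by move/(normalizedV (normalizedX b nN))/(normalizedX a nN).
by move=> h; apply/(normalizedV (normalizedX b nN))/(normalizedX a nN).
Qed.

Lemma cyclic_extension_subgroup N g : is_subgroup N -> normalized N g ->
  is_subgroup (cyclic_extension N g).
Proof.
move=> [N1 NM NV] nN; split.
- by exists 1, 1; split => //; [exact: zpowers1|rewrite mulg1].
- move=> _ _ [n [u [Nn zu ->]]] [m [v [Nm zv ->]]].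
  exists (n * m ^ u^-1), (u * v); split; last by rewrite conjgE !gnorm.
    by apply: NM => //; apply/(normalized_zpowers nN (zpowersV zu)).
  exact: zpowersM.
- move=> _ [n [u [Nn zu ->]]]; exists (n^-1 ^ u), u^-1; split.
  + by apply/(normalized_zpowers nN zu); exact: NV.
  + exact: zpowersV.
  + by rewrite conjgE !gnorm.
Qed.

Lemma cyclic_extension_base N g : N `<=` cyclic_extension N g.
Proof. by move=> x Nx; exists x, 1; split => //; [exact: zpowers1|rewrite mulg1]. Qed.

Lemma cyclic_extension_gen N g : N 1 -> zpowers g `<=` cyclic_extension N g.
Proof. by move=> N1 u zu; exists 1, u; rewrite mul1g. Qed.

Lemma poly_Z_subgroup H : poly_Z H -> is_subgroup H.
Proof.
elim=> [|N g _ sN nN _]; last exact: cyclic_extension_subgroup.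
by split => //= [x y -> ->|x ->]; rewrite ?mulg1 ?invg1.
Qed.

(* [P] is the positive cone of a left-invariant total order on [H]: the
   elements above [N] are those with positive exponent of [g]. *)
Lemma poly_Z_cone H : poly_Z H -> exists P,
  [/\ ~ P 1, forall x y, P x -> P y -> P (x * y)
    & forall x, H x -> [\/ x = 1, P x | P x^-1]].
Proof.
elim=> [|N g pN [P [P1 PM Ptot]] nN gN].
  by exists set0; split => // x ->; apply: Or31.
have [N1 NM NV] := poly_Z_subgroup pN.
pose Q x := (N x /\ P x) \/ exists n k, N n /\ x = n * g ^+ k.+1.
exists Q; split.
- case=> [[]//|[n [k [Nn /esym/eqP]]]].
  rewrite mulg_eq1 => /eqP e.
  by apply: (gN k); rewrite -[g ^+ _]invgK -e; exact: NV.
- move=> x y [[Nx Px]|[n [k [Nn ->]]]] [[Ny Py]|[m [l [Nm ->]]]].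
  + by left; split; [exact: NM|exact: PM].
  + by right; exists (x * m), l; split; [exact: NM|rewrite mulgA].
  + right; exists (n * y ^ (g ^- k.+1)), k; split; last by rewrite conjgE !gnorm.
    by apply: NM => //; apply/(normalizedV (normalizedX k.+1 nN)).
  + right; exists (n * m ^ (g ^- k.+1)), (k + l.+1)%N; split.
      by apply: NM => //; apply/(normalizedV (normalizedX k.+1 nN)).
    by rewrite -addSn expgnDr conjgE !gnorm.
- move=> _ [n [u [Nn zu ->]]]; case: (zpowersP zu) => [->|[k [->|->]]].
  + rewrite mulg1; case: (Ptot n Nn) => [->|Pn|Pn].
    * exact: Or31.
    * by apply: Or32; left.
    * by apply: Or33; left; split => //; exact: NV.
  + by apply: Or32; right; exists n, k.
  + apply: Or33; right; exists (n^-1 ^ g ^- k.+1), k.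
    split; last by rewrite conjgE !gnorm.
    by apply/(normalizedV (normalizedX k.+1 nN)); exact: NV.
Qed.

(** With [P (y^-1 * m)] read as y < m, this is the maximum of a nonempty list: the head is compared
    with the maximum of the tail. *)
Lemma cone_max P H (s : seq G) : (forall x y, P x -> P y -> P (x * y)) ->
  is_subgroup H -> (forall x, H x -> [\/ x = 1, P x | P x^-1]) ->
  (forall x, x \in s -> H x) -> s != [::] ->
  exists2 m, m \in s & forall y, y \in s -> y != m -> P (y^-1 * m).
Proof.
move=> PM [] H1 HM HV Ptot; elim: s => [//|x s IH] sH _.
have [->|s0] := eqVneq s [::].
  by exists x; rewrite ?mem_head // => y; rewrite inE => /eqP ->; rewrite eqxx.
have [|m ms mmax] := IH _ s0; first by move=> y ys; apply: sH; rewrite inE ys orbT.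
have Hx : H x by apply: sH; rewrite mem_head.
have Hm : H m by apply: sH; rewrite inE ms orbT.
have [e|Pxm|Pmx] := Ptot (x^-1 * m) (HM _ _ (HV _ Hx) Hm).
- have {}e : m = x by rewrite -[m](mulVKg x) e mulg1.
  exists m; first by rewrite inE ms orbT.
  by move=> y; rewrite inE => /orP[/eqP -> | /mmax //]; rewrite e eqxx.
- exists m; first by rewrite inE ms orbT.
  by move=> y; rewrite inE => /orP[/eqP -> | /mmax //].
- exists x; first by rewrite mem_head.
  move=> y; rewrite inE => /orP[/eqP -> | ys]; first by rewrite eqxx.
  move=> _; rewrite invgM invgK in Pmx.
  have [-> //|ym] := eqVneq y m.
  by have := PM _ _ (mmax y ys ym) Pmx; rewrite !gnorm.
Qed.

(* The maximal product [h1 * g0], with [g0] the maximum of the support of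
   [b], is attained only once, so it cannot cancel. *)
Lemma poly_Z_domain (K : fieldType) H (b : G -> K) (B s : seq G) (c : G -> K) :
  poly_Z H -> (forall h, H h -> b h != 0%R -> h \in B) ->
  (exists2 h, H h & b h != 0%R) -> uniq s -> (forall h, h \in s -> H h) ->
  (forall g, H g -> (\sum_(h <- s) c h * b (h^-1 * g)%g = 0)%R) ->
  forall h, h \in s -> c h = 0%R.
Proof.
move=> pH bB [hb Hhb bhb] us sH sum0 h hs.
have [P [P1 PM Ptot]] := poly_Z_cone pH.
have sgH := poly_Z_subgroup pH; have [H1 HM HV] := sgH.
apply/eqP; apply/negPn/negP => ch0.
pose B' := [seq x <- B | (b x != 0%R) && `[< H x >]].
have [||g0] := @cone_max P H B' PM sgH Ptot.
- by move=> x; rewrite mem_filter => /andP[/andP[_ /asboolP]].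
- have : hb \in B' by rewrite mem_filter bhb bB // andbT; apply/asboolP.
  by case: B'.
rewrite mem_filter => /andP[/andP[bg0 /asboolP Hg0] g0B] g0max.
pose s' := [seq x * g0 | x <- s & c x != 0%R].
have [||_ /mapP[h1 + ->]] := @cone_max P H s' PM sgH Ptot.
- move=> x /mapP[y]; rewrite mem_filter => /andP[_ ys] ->.
  by apply: HM => //; exact: sH.
- have : h * g0 \in s' by apply: map_f; rewrite mem_filter ch0.
  by case: s'.
rewrite mem_filter => /andP[ch1 h1s] h1max.
have Hh1 := sH _ h1s.
have /eqP := sum0 (h1 * g0) (HM _ _ Hh1 Hg0).
rewrite (bigD1_seq h1) //= mulKg big_seq_cond big1 ?addr0 => [|k].
  by rewrite mulf_eq0 (negPf ch1) (negPf bg0).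
case/andP=> ks kh1; apply/eqP; rewrite mulf_eq0; apply/negPn/negP.
rewrite negb_or => /andP[ck bk].
set y := _ * _ in bk.
have Hy : H y by apply: (HM); [exact/HV/sH|exact: HM].
have yB : y \in B' by rewrite mem_filter bk bB // andbT; apply/asboolP.
have yg0 : y != g0.
  apply: contraNneq kh1 => e; apply/eqP; apply: (@mulIg _ g0).
  by rewrite -{1}e /y mulVKg.
have kP : P ((k * g0)^-1 * (h1 * g0)).
  apply: h1max; last by rewrite (inj_eq (@mulIg _ g0)).
  by apply: map_f; rewrite mem_filter ck.
(* By left invariance y < g0 gives h1 g0 < k g0, against [kP]; the product of the two cone elements
   is 1, which is not in [P]. *)
have := PM _ _ kP (g0max _ yB yg0); rewrite /y !gnorm.
by [].
Qed.

End PolyZ.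

(** * Polycyclic-by-finite groups are virtually poly-(infinite cyclic) *)

Lemma nat_pigeonhole (T : finType) (f : nat -> T) :
  exists i j, (i < j)%N /\ f i = f j.
Proof.
apply: contrapT => nf.
have finj : injective (fun i : 'I_(#|T|.+1) => f i).
  move=> i j e; apply/val_inj => /=; apply: contrapT => ij; apply: nf.
  by case: (ltngtP i j) ij => // [lt|lt] _; [exists i, j|exists j, i].
by have := leq_card _ finj; rewrite card_ord ltnn.
Qed.

Section VirtuallyPolyZ.
Variable G : groupType.
Local Open Scope group_scope.
Implicit Types (N H P : set G) (g x y u : G).

(* The conjugates of [N0] by powers of [g] all have the same finite index in
   the finitely generated group [N], so two of them coincide: they are read
   off the action of the generators on cosets. *)
Lemma power_normalizes N N0 g : is_subgroup N -> is_subgroup N0 ->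
  N0 `<=` N -> finitely_generated N -> index_finite_in N N0 ->
  normalized N g -> exists k, normalized N0 (g ^+ k.+1).
Proof.
move=> [N1 NM NV] [O1 OM OV] N0N [s [sN sgen]] [t tN] nN.
have ex_rep y : exists r, N y -> r \in t /\ N0 (r^-1 * y).
  have [Ny|] := pselect (N y); last by exists 1.
  have [c [h [ct Oh ->]]] := tN y Ny.
  by exists c => _; split => //; rewrite mulKg.
pose rep y := proj1_sig (cid (ex_rep y)).
have repP y : N y -> rep y \in t /\ N0 ((rep y)^-1 * y).
  by rewrite /rep; case: cid.
(* [D j] tabulates how the generators conjugated by [g ^+ j] move the coset representatives; there
   are finitely many tables, so two exponents share one. *)
pose D j : {ffun seq_sub s * seq_sub t -> option (seq_sub t)} :=
  [ffun p => insub (rep (val p.1 ^ (g ^+ j) * val p.2))].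
have [i [j [ltij Dij]]] := nat_pigeonhole D.
have NJ k x : N x -> N (x ^ (g ^+ k)) by move/(normalizedX k nN).
(* The elements whose conjugates by [g ^+ i] and [g ^+ j] act alike on the left cosets of [N0]: a
   subgroup containing the generators. *)
pose P : set G := [set x | N x /\
  forall y, N y -> N0 ((x ^ (g ^+ i) * y)^-1 * (x ^ (g ^+ j) * y))].
have PN : N `<=` P.
  apply: sgen.
    split.
    - by split => // y _; rewrite !conj1g !gnorm.
    - move=> x x' [Nx Px] [Nx' Px']; split; first exact: NM.
      move=> y Ny; rewrite !conjMg.
      have := OM _ _ (Px _ (NM _ _ (NJ i _ Nx') Ny)) (Px' _ Ny).
      by rewrite !gnorm.
    - move=> x [Nx Px]; split; first exact: NV.
      move=> y Ny; rewrite !conjVg.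
      have := OV _ (Px _ (NM _ _ (NV _ (NJ j _ Nx)) Ny)).
      by rewrite !gnorm.
  move=> x xs; split; first exact: sN.
  move=> y Ny; have [c [h [ct Oh ye]]] := tN y Ny.
  have Nc : N c.
    rewrite -[c](mulgK h) -ye; apply: (NM) => //; apply: NV; exact: N0N.
  have Nk k : N (x ^ (g ^+ k) * c) by apply: (NM) => //; exact/NJ/sN.
  have := congr1 (fun d : {ffun _} => d (SeqSub xs, SeqSub ct)) Dij.
  rewrite !ffunE /=.
  have [it iO] := repP _ (Nk i); have [jt jO] := repP _ (Nk j).
  rewrite !insubT => -[e]; rewrite e in iO.
  have := OM _ _ (OV _ iO) jO; rewrite !gnorm => cO.
  rewrite ye; have := OM _ _ (OM _ _ (OV _ Oh) cO) Oh.
  by rewrite !gnorm.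
exists (j - i).-1; rewrite prednK ?subn_gt0 // => n.
(* Evaluation at the coset of 1 puts [n] and its conjugate by [g ^+ (j - i)] in the same left coset
   of [N0]. *)
have key : N n -> N0 (n^-1 * n ^ (g ^+ (j - i))).
  move=> Nn; have Nx : N (n ^ g ^- i).
    by apply/(normalizedV (normalizedX i nN)).
  have [_ /(_ 1 N1)] := PN _ Nx; rewrite !mulg1 -!conjgM mulVg conjg1.
  by rewrite -{1}(subnKC (ltnW ltij)) expgnDr mulKg.
split=> [O|O].
  have Nn : N n by apply/(normalizedX (j - i) nN); exact: N0N.
  by have := OM _ _ O (OV _ (key Nn)); rewrite invgM invgK mulVKg.
have := OM _ _ O (key (N0N _ O)); by rewrite mulVKg.
Qed.

Lemma index_finite_in_trans H N P : index_finite_in H N -> index_finite_in N P ->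
  index_finite_in H P.
Proof.
move=> [s sH] [t tN]; exists [seq x * y | x <- s, y <- t] => x Hx.
have [c [h [cs Nh ->]]] := sH x Hx; have [d [k [dt Pk ->]]] := tN h Nh.
by exists (c * d), k; rewrite mulgA; split => //; exact: allpairs_f.
Qed.

Lemma cyclic_quotientP H N : is_subgroup H -> is_subgroup N ->
  is_normal_in N H -> cyclic_quotient H N ->
  exists g, [/\ H g, normalized N g &
    forall x, H x -> exists u n, [/\ zpowers g u, N n & x = u * n]].
Proof.
move=> [H1 HM HV] [N1 NM NV] [NH nN] [g Hg gen]; exists g; split => //.
  move=> x; split=> [/(nN g)|/(nN _ _ (HV _ Hg))].
    by move=> /(_ Hg); rewrite conjgE !gnorm.
  by rewrite conjgE !gnorm.
move=> x /gen[z e]; have : left_coset N x x by exists 1; rewrite ?mulg1.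
rewrite e => -[n Nn <-]; exists (expgz g z), n; split => //.
exact: zpowers_expgz.
Qed.

Definition virtually_poly_Z H := exists N,
  [/\ poly_Z N, N `<=` H & index_finite_in H N].

(** If a positive power of [g] lies in [N], then [N] has finite index in [H] and [N0] still serves.
    Otherwise some power of [g] normalizes [N0], and extending [N0] by it gives the new subgroup.
    Finite generation is carried along for [power_normalizes]. *)
Lemma virtually_poly_Z_step H N : is_subgroup H -> is_subgroup N ->
  is_normal_in N H -> cyclic_quotient H N ->
  finitely_generated N -> virtually_poly_Z N ->
  finitely_generated H /\ virtually_poly_Z H.
Proof.
move=> sH sN nNH cHN [s [sN' sgen]] [N0 [pN0 N0N iN0]].
have [NH _] := nNH.
have [g [Hg nN gen]] := cyclic_quotientP sH sN nNH cHN.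
have [H1 HM HV] := sH; have [N1 NM NV] := sN.
split.
  exists (g :: s); split.
    by move=> x; rewrite inE => /orP[/eqP ->//|/sN'/NH].
  move=> P sP gP x /gen[u [n [zu Nn ->]]]; have [_ PM _] := sP.
  apply: PM.
    by apply: zpowers_sub zu => //; apply: gP; rewrite mem_head.
  by apply: (sgen P) => // y ys; apply: gP; rewrite inE ys orbT.
have sN0 := poly_Z_subgroup pN0; have [O1 OM OV] := sN0.
have [[k gk]|ngk] := pselect (exists k, N (g ^+ k.+1)).
  exists N0; split => //; first by move=> x /N0N/NH.
  apply: index_finite_in_trans iN0.
  exists [seq g ^+ i | i <- iota 0 k.+1] => x /gen[u [n [zu Nn ->]]].
  suff [a [m [ak Nm ->]]] : exists a m, [/\ (a < k.+1)%N, N m & u = g ^+ a * m].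
    exists (g ^+ a), (m * n); split; [|exact: NM|by rewrite mulgA].
    by apply: map_f; rewrite mem_iota.
  have gkX q : N (g ^+ (q * k.+1)).
    elim: q => [//|q IH]; rewrite mulSn expgnDr; exact: NM.
  have pos b : exists a m, [/\ (a < k.+1)%N, N m & g ^+ b = g ^+ a * m].
    exists (b %% k.+1)%N, (g ^+ (b %/ k.+1 * k.+1)); split => //.
      by rewrite ltn_mod.
    by rewrite -expgnDr addnC -divn_eq.
  case: (zpowersP zu) => [->|[b [->|->]]]; [exact: (pos 0%N)|exact: pos|].
  (* A negative exponent is reduced through -(b+1) = (b+1)k - (b+1)(k+1), whose first term is a
     natural number. *)
  have [a [m [ak Nm e]]] := pos (b.+1 * k)%N.
  exists a, (m * (g ^+ (b.+1 * k.+1))^-1); split => //.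
    by apply: NM => //; exact: NV.
  by rewrite mulgA -e (mulnS b.+1 k) (expgnDr g b.+1 (b.+1 * k)) invgM mulVKg.
have [k nO] := power_normalizes sN sN0 N0N (ex_intro _ s (conj sN' sgen)) iN0 nN.
exists (cyclic_extension N0 (g ^+ k.+1)); split.
- apply: poly_Z_extension => // l; rewrite -expgnA mulnS addSn => /N0N gl.
  by apply: ngk; exists (k + k.+1 * l)%N.
- move=> _ [n [u [/N0N/NH Hn zu ->]]]; apply: HM => //.
  by apply: zpowers_sub zu => //; exact: (zpowers_sub sH Hg (zpowersX g k.+1)).
- have [t tN] := iN0.
  exists [seq g ^+ i * c | i <- iota 0 k.+1, c <- t] => x /gen[u [n [zu Nn ->]]].
  have [a [v [ak zv ->]]] : exists a v,
      [/\ (a < k.+1)%N, zpowers (g ^+ k.+1) v & u = g ^+ a * v].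
    have pos b : exists a v,
        [/\ (a < k.+1)%N, zpowers (g ^+ k.+1) v & g ^+ b = g ^+ a * v].
      exists (b %% k.+1)%N, (g ^+ (k.+1 * (b %/ k.+1))); split.
      + by rewrite ltn_mod.
      + by rewrite expgnA; exact: zpowersX.
      + by rewrite -expgnDr addnC mulnC -divn_eq.
    case: (zpowersP zu) => [->|[b [->|->]]]; [exact: (pos 0%N)|exact: pos|].
    have [a [v [ak zv e]]] := pos (b.+1 * k)%N.
    exists a, (v * (g ^+ (k.+1 * b.+1))^-1); split => //.
      apply: zpowersM => //; apply: zpowersV; rewrite expgnA; exact: zpowersX.
    by rewrite mulgA -e (mulnC k.+1) (mulnS b.+1 k) (expgnDr g b.+1 (b.+1 * k))
      invgM mulVKg.
  have zgv : zpowers g v.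
    case: zv => p [q ->]; rewrite -!expgnA; apply: zpowersM; first exact: zpowersX.
    by apply: zpowersV; exact: zpowersX.
  (* Writing v n as (v n v^-1) v leaves [v] on the right, where it belongs to the extension, and an
     element of [N] to split along the cosets of [N0]. *)
  have Nnv : N (n ^ v^-1) by apply/(normalized_zpowers nN (zpowersV zgv)).
  have [c [h [ct Oh e]]] := tN _ Nnv.
  exists (g ^+ a * c), (h * v); split.
  + by apply: allpairs_f => //; rewrite mem_iota.
  + by exists h, v.
  + by rewrite -[RHS]mulgA (mulgA c) -e conjgE !gnorm.
Qed.

Lemma polycyclic_virtually_poly_Z H : polycyclic H -> virtually_poly_Z H.
Proof.
move=> [n [S [<- Sn sS step]]].
(* Induction climbs the series from its trivial end, [k] counting the steps made. *)
suff : forall k, (k <= n)%N ->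
    finitely_generated (S (n - k)%N) /\ virtually_poly_Z (S (n - k)%N).
  by move=> /(_ n (leqnn n)); rewrite subnn => -[].
elim=> [_|k IH kn].
  rewrite subn0 Sn; split.
    by exists [::]; split => // P [P1 _ _] _ _ ->.
  exists [set 1]; split => //; first exact: poly_Z_trivial.
  by exists [:: 1] => x ->; exists 1, 1; rewrite mem_head mulg1.
have [fN vN] := IH (ltnW kn).
have lt : (n - k.+1 < n)%N by rewrite ltn_subrL (leq_ltn_trans _ kn).
have e : (n - k = (n - k.+1).+1)%N by rewrite subnSK.
have [nS cS] := step _ lt; rewrite e in fN vN.
apply: (virtually_poly_Z_step _ _ nS cS fN vN); apply: sS => //.
exact: leq_subr.
Qed.

Lemma polycyclic_by_finite_poly_Z : polycyclic_by_finite G ->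
  exists H, poly_Z H /\ index_finite_in setT H.
Proof.
move=> [H [[H1 HM HV] pH fH]].
have [N [pN NH iN]] := polycyclic_virtually_poly_Z pH.
exists N; split => //; apply: index_finite_in_trans iN.
(* One representative is chosen per coset; sets that are not cosets get the placeholder 1. *)
have ex C : exists r, range (left_coset H) C -> C = left_coset H r.
  have [[r _ <-]|nC] := pselect (range (left_coset H) C); first by exists r.
  by exists 1.
pose r C := proj1_sig (cid (ex C)).
have rP C : range (left_coset H) C -> C = left_coset H (r C).
  by rewrite /r; case: cid.
have /finite_seqP[s se] : finite_set (r @` range (left_coset H)).
  exact: finite_image.
exists s => x _.
have xr : range (left_coset H) (left_coset H x) by exists x.
have : left_coset H x x by exists 1; rewrite ?mulg1.
rewrite (rP _ xr) => -[h Hh <-]; exists (r (left_coset H x)), h; split => //.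
have : (r @` range (left_coset H)) (r (left_coset H x)) by exists (left_coset H x).
by rewrite se.
Qed.

End VirtuallyPolyZ.

Local Open Scope ring_scope.

(** * Subspaces and linear group actions *)

Section Subspaces.
Variables (K : fieldType) (V : lmodType K).
Implicit Types (P Q W : set V).

Definition is_subspace P :=
  [/\ P 0, forall x y, P x -> P y -> P (x + y) & forall a x, P x -> P (a *: x)].

Lemma subspaceB P x y : is_subspace P -> P x -> P y -> P (x - y).
Proof. by case=> _ PD PZ Px Py; rewrite -scaleN1r; apply: PD => //; exact: PZ. Qed.

Lemma subspace_sum P I (r : seq I) (F : I -> V) : is_subspace P ->
  (forall i, P (F i)) -> P (\sum_(i <- r) F i).
Proof. by case=> P0 PD _ PF; elim/big_ind: _. Qed.

Lemma subspace_chain (P : nat -> set V) :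
  (forall i, P i `<=` P i.+1) -> forall i j, (i <= j)%N -> P i `<=` P j.
Proof.
move=> mP i j /subnK <-; elim: (j - i)%N => [//|k IH] x /IH Px.
by rewrite addSn; exact: mP.
Qed.

Lemma subspaceI P Q : is_subspace P -> is_subspace Q -> is_subspace (P `&` Q).
Proof.
move=> [P0 PD PZ] [Q0 QD QZ]; split => //.
- by move=> x y [Px Qx] [Py Qy]; split; [exact: PD|exact: QD].
- by move=> a x [Px Qx]; split; [exact: PZ|exact: QZ].
Qed.

End Subspaces.

Record linear_action (K : fieldType) (G : groupType) (V : lmodType K) := LinearAction {
  act :> G -> V -> V;
  actD : forall g x y, act g (x + y) = act g x + act g y;
  actZ : forall g a x, act g (a *: x) = a *: act g x;
  act1 : forall x, act 1%g x = x;
  actM : forall g h x, act (g * h)%g x = act g (act h x) }.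

(** * Noetherian modules over group algebras: the Hilbert basis argument *)

Section Noetherian.
Variables (K : fieldType) (G : groupType) (V : lmodType K).
Variable rho : linear_action G V.
Implicit Types (H N : set G) (P Q W : set V) (g h : G).

Lemma act0 g : rho g 0 = 0.
Proof. by rewrite -(scale0r 0) actZ !scale0r. Qed.

Lemma actK g x : rho g^-1%g (rho g x) = x.
Proof. by rewrite -actM mulVg act1. Qed.

Lemma act_sum g I (r : seq I) (F : I -> V) :
  rho g (\sum_(i <- r) F i) = \sum_(i <- r) rho g (F i).
Proof.
elim: r => [|i r IH]; first by rewrite !big_nil act0.
by rewrite !big_cons actD IH.
Qed.

Definition is_invariant H P := forall h v, H h -> P v -> P (rho h v).

(** The ascending chain condition for the K[H]-module [W]; the chain consists of submodules of [V],
    compared only inside [W]. *)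
Definition noetherian H W := [/\ is_subspace W, is_invariant H W &
  forall P : nat -> set V, (forall i, is_subspace (P i)) ->
    (forall i, is_invariant H (P i)) -> (forall i, P i `<=` P i.+1) ->
    exists m, forall i, (m <= i)%N -> P i `&` W `<=` P m].

Section HilbertBasis.
Variables (N : set G) (g : G) (W : set V).
Hypotheses (sN : is_subgroup N) (nN : normalized N g) (nW : noetherian N W).

(** Polynomials of degree below [n] in the variable [g], with coefficients in [W]. *)
Fixpoint powers_below n : set V := if n is m.+1 then
  [set v | exists w u, [/\ W w, powers_below m u & v = rho (g ^+ m)%g w + u]]
  else [set 0].

(** Leading coefficients of the degree [n] elements of [P]; membership in [W] is imposed only when
    two such sets are compared. *)
Definition lead_coefs P n : set V :=
  [set w | exists2 u, powers_below n u & P (rho (g ^+ n)%g w + u)].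

(** Laurent polynomials in [g]: the elements that some power of [g] turns into polynomials. *)
Definition cyclic_span : set V :=
  [set v | exists n m, powers_below m (rho (g ^+ n)%g v)].

Let H := cyclic_extension N g.

Lemma powers_below_subspace n : is_subspace (powers_below n).
Proof.
have [[W0 WD WZ] _ _] := nW.
elim: n => [|n [U0 UD UZ]] /=.
  by split => // [x y -> ->|a x ->]; rewrite ?addr0 ?scaler0.
split.
- by exists 0, 0; rewrite act0 addr0.
- move=> _ _ [w [u [Ww Uu ->]]] [w' [u' [Ww' Uu' ->]]].
  exists (w + w'), (u + u'); split; [exact: WD|exact: UD|].
  by rewrite actD addrACA.
- move=> a _ [w [u [Ww Uu ->]]]; exists (a *: w), (a *: u).
  by split; [exact: WZ|exact: UZ|rewrite actZ scalerDr].
Qed.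

Lemma normalizer_swap h k v :
  rho h (rho (g ^+ k)%g v) = rho (g ^+ k)%g (rho (h ^ (g ^+ k))%g v).
Proof. by rewrite -!actM conjgE mulVKg. Qed.

Lemma powers_below_invariant n : is_invariant N (powers_below n).
Proof.
have [_ iW _] := nW.
elim: n => [|n IH] h v Nh /=; first by move=> ->; rewrite act0.
move=> [w [u [Ww Uu ->]]]; exists (rho (h ^ (g ^+ n))%g w), (rho h u); split.
- by apply: iW => //; apply/(normalizedX n nN).
- exact: IH.
- by rewrite actD normalizer_swap.
Qed.

Lemma powers_below_shift n v : powers_below n v -> powers_below n.+1 (rho g v).
Proof.
have [[W0 _ _] _ _] := nW.
elim: n v => [|n IH] v.
  by move=> ->; exists 0, 0; rewrite !act0 addr0.
move=> [w [u [Ww /IH Uu ->]]]; exists w, (rho g u); split => //.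
by rewrite actD -actM expgS.
Qed.

Lemma powers_below_mono n m : (n <= m)%N -> powers_below n `<=` powers_below m.
Proof.
apply: subspace_chain => {n m} n v Uv; have [[W0 _ _] _ _] := nW.
by exists 0, v; rewrite act0 add0r.
Qed.

Lemma powers_below_shiftn k n v : powers_below n v ->
  powers_below (k + n) (rho (g ^+ k)%g v).
Proof.
elim: k => [|k IH] Uv; first by rewrite expg0 act1.
by rewrite expgS actM addSn; apply/powers_below_shift/IH.
Qed.

Lemma lead_coefs_subspace P n : is_subspace P -> is_subspace (lead_coefs P n).
Proof.
move=> [P0 PD PZ]; have [U0 UD UZ] := powers_below_subspace n; split.
- by exists 0; rewrite // act0 addr0.
- move=> w w' [u Uu Pu] [u' Uu' Pu']; exists (u + u'); first exact: UD.
  by rewrite actD addrACA; exact: PD.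
- move=> a w [u Uu Pu]; exists (a *: u); first exact: UZ.
  by rewrite actZ -scalerDr; exact: PZ.
Qed.

(** Acting by [h] on the coefficient of [g ^+ n] amounts to acting on the whole polynomial by a
    conjugate of [h]. *)
Lemma lead_coefs_invariant P n : is_invariant N P -> is_invariant N (lead_coefs P n).
Proof.
move=> iP h w Nh [u Uu Pu]; pose h' := (h ^ (g ^- n))%g.
have Nh' : N h' by apply/(normalizedV (normalizedX n nN)).
exists (rho h' u); first exact: powers_below_invariant.
suff -> : rho (g ^+ n)%g (rho h w) = rho h' (rho (g ^+ n)%g w).
  by rewrite -actD; exact: iP.
by rewrite normalizer_swap /h' conjgKV.
Qed.

(** Multiplication by [g] raises the degree and keeps the leading coefficient. *)
Lemma lead_coefs_mono P Q n m : is_invariant [set g] P -> (n <= m)%N -> P `<=` Q ->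
  lead_coefs P n `<=` lead_coefs Q m.
Proof.
move=> iP nm PQ w Lw.
suff : lead_coefs P m w by case=> u Uu /PQ; exists u.
move: nm w Lw; apply: (@subspace_chain _ _ (lead_coefs P)) => {n m} n w [u Uu Pu].
exists (rho g u); first exact: powers_below_shift.
by rewrite expgS actM -actD; exact: iP.
Qed.

(** Induction on the degree: subtracting an element of [P] with the same leading term leaves an
    element of [Q] of lower degree. *)
Lemma lead_coefs_determine P Q : is_subspace P -> is_subspace Q -> P `<=` Q ->
  (forall n, lead_coefs Q n `&` W `<=` lead_coefs P n) ->
  forall n, powers_below n `&` Q `<=` P.
Proof.
move=> sP sQ PQ LQP; elim=> [|n IH] v [Uv Qv].
  by rewrite Uv; case: sP.
case: Uv Qv => w [u [Ww Uu ->]] Qv.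
have [u' Uu' Pu'] : lead_coefs P n w by apply: LQP; split => //; exists u.
have [_ PD _] := sP.
have -> : rho (g ^+ n)%g w + u = (rho (g ^+ n)%g w + u') + (u - u').
  by rewrite addrACA subrr addr0.
apply: (PD) => //; apply: IH; split.
  exact: subspaceB (powers_below_subspace n) _ _.
have := subspaceB sQ Qv (PQ _ Pu'); by rewrite opprD addrACA subrr add0r.
Qed.

Lemma gen_in_extension : H g.
Proof.
have [N1 _ _] := sN.
by apply: cyclic_extension_gen => //; exact: (zpowersX g 1).
Qed.

Lemma cyclic_span_subspace : is_subspace cyclic_span.
Proof.
have raise n m v k : powers_below m (rho (g ^+ n)%g v) ->
    powers_below (k + m) (rho (g ^+ (k + n))%g v).
  by move=> Uv; rewrite expgnDr actM; exact: powers_below_shiftn.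
split.
- by exists 0%N, 0%N; rewrite act0.
- move=> x y [n [m Ux]] [n' [m' Uy]]; exists (n' + n)%N, (maxn (n' + m) (n + m')).
  have [_ UD _] := powers_below_subspace (maxn (n' + m) (n + m')).
  rewrite actD; apply: UD.
    by apply: (powers_below_mono (leq_maxl _ _)); exact: raise.
  by apply: (powers_below_mono (leq_maxr _ _)); rewrite (addnC n' n); exact: raise.
- move=> a x [n [m Ux]]; exists n, m; rewrite actZ.
  by have [_ _ UZ] := powers_below_subspace m; exact: UZ.
Qed.

Lemma cyclic_span_invariant : is_invariant H cyclic_span.
Proof.
move=> _ v [h [u [Nh [a [b ->]] ->]]] [n [m Uv]].
(* The exponent [n + b] absorbs the inverse power [g ^- b]; [h] then moves to the far left as a
   conjugate. *)
exists (n + b)%N, (a + m)%N.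
have -> : rho (g ^+ (n + b))%g (rho (h * (g ^+ a * g ^- b))%g v) =
    rho (h ^ (g ^- (n + b)))%g (rho (g ^+ a)%g (rho (g ^+ n)%g v)).
  rewrite -!actM; congr (rho _ _).
  have e : (g ^- (n + b) * (g ^+ a * g ^+ n) = g ^+ a * g ^- b)%g.
    by rewrite commXV -expgnDr (addnC a n) !expgnDr !gnorm.
  by rewrite conjgE invgK -e !gnorm.
apply: powers_below_invariant; first by apply/(normalizedV (normalizedX _ nN)).
exact: powers_below_shiftn.
Qed.

Lemma sub_cyclic_span : W `<=` cyclic_span.
Proof. by move=> w Ww; exists 0%N, 1%N, w, 0; rewrite !act1 addr0. Qed.

(** The diagonal chain [lead_coefs (P i) i] becomes stationary at some [m0], which settles all
    degrees from [m0] on; each of the finitely many lower degrees has a chain of its own. Past the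
    largest bound, [lead_coefs_determine] applies. *)
Lemma cyclic_span_noetherian : noetherian H cyclic_span.
Proof.
split; [exact: cyclic_span_subspace|exact: cyclic_span_invariant|].
move=> P sP iP mP; have [_ _ accW] := nW.
have iPN i : is_invariant N (P i).
  by move=> h v Nh; apply: iP; exact: cyclic_extension_base.
have iPg i : is_invariant [set g] (P i).
  by move=> _ v ->; apply: iP; exact: gen_in_extension.
have mono n m i j : (n <= m)%N -> (i <= j)%N ->
    lead_coefs (P i) n `<=` lead_coefs (P j) m.
  by move=> nm ij; apply: lead_coefs_mono => //; exact: (subspace_chain mP).
have [m0 stab] : exists m, forall i, (m <= i)%N ->
    lead_coefs (P i) i `&` W `<=` lead_coefs (P m) m.
  apply: (accW (fun i => lead_coefs (P i) i)) => i.
  - exact: lead_coefs_subspace.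
  - exact: lead_coefs_invariant.
  - exact: mono.
have stabn n : exists m, forall i, (m <= i)%N ->
    lead_coefs (P i) n `&` W `<=` lead_coefs (P m) n.
  apply: (accW (fun i => lead_coefs (P i) n)) => i.
  - exact: lead_coefs_subspace.
  - exact: lead_coefs_invariant.
  - exact: mono.
pose mn n := proj1_sig (cid (stabn n)).
have mnP n i : (mn n <= i)%N -> lead_coefs (P i) n `&` W `<=` lead_coefs (P (mn n)) n.
  by rewrite /mn; case: cid => ? /=; apply.
pose M := maxn m0 (\max_(n < m0) mn n).
exists M => i Mi v [Pv [n [m Uv]]].
suff LL k : lead_coefs (P i) k `&` W `<=` lead_coefs (P M) k.
  have Piv : P i (rho (g ^+ n)%g v).
    by apply: iP => //; apply: (cyclic_extension_gen _ (zpowersX g n)); case: sN.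
  have := lead_coefs_determine (sP M) (sP i) (subspace_chain mP Mi) LL (conj Uv Piv).
  move/(iP M (g ^- n)%g); rewrite actK; apply.
  by apply: (cyclic_extension_gen _ (zpowersV (zpowersX g n))); case: sN.
have [km|km] := ltnP k m0.
  have kM : (mn k <= M)%N.
    by rewrite leq_max (leq_bigmax (F := fun n : 'I_m0 => mn n) (Ordinal km)) orbT.
  by move=> w /(mnP _ _ (leq_trans kM Mi)); apply: mono.
move=> w [Lw Ww].
(* Degrees from [m0] on: move up to the diagonal, down to [m0] by stationarity, then up again to
   degree [k]. *)
have : lead_coefs (P (maxn k i)) (maxn k i) w.
  by apply: mono Lw; rewrite ?leq_maxl ?leq_maxr.
move=> Lw'; apply: (mono m0 k m0 M km (leq_maxl _ _)).
by apply: (stab (maxn k i)); rewrite // leq_max km.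
Qed.

End HilbertBasis.

(** Either no [P i] contains an element v + w with w in [W], and then only the part in [W] counts,
    or from some stage on such an element reduces everything to [W]. *)
Lemma span_cons_noetherian (v : V) W : noetherian [set 1%g] W ->
  noetherian [set 1%g] [set x | exists a w, W w /\ x = a *: v + w].
Proof.
move=> [[W0 WD WZ] iW accW]; split.
- split.
  + by exists 0, 0; rewrite scale0r addr0.
  + move=> _ _ [a [w [Ww ->]]] [b [w' [Ww' ->]]]; exists (a + b), (w + w').
    by split; [exact: WD|rewrite scalerDl addrACA].
  + move=> b _ [a [w [Ww ->]]]; exists (b * a), (b *: w).
    by split; [exact: WZ|rewrite scalerDr scalerA].
- by move=> h x -> Wx; rewrite act1.
move=> P sP iP mP; have [m stab] := accW P sP iP mP.
have [[i [w [Ww Pw]]]|nv] := pselect (exists i w, W w /\ P i (v + w)); last first.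
  exists m => i mi x [Px [a [w [Ww xe]]]]; rewrite xe in Px *.
  have [a0|a0] := eqVneq a 0.
    rewrite a0 scale0r add0r in Px *; exact: (stab i mi).
  exfalso; apply: nv; exists i, (a^-1 *: w); split; first exact: WZ.
  have [_ _ PZ] := sP i; have := PZ a^-1 _ Px.
  by rewrite scalerDr scalerA mulVf // scale1r.
exists (maxn m i) => j; rewrite geq_max => /andP[mj ij] x [Px [a [w' [Ww' xe]]]].
rewrite xe in Px *.
have PwM : P (maxn m i) (a *: (v + w)).
  have [_ _ PZ] := sP (maxn m i); apply: PZ.
  by apply: (subspace_chain mP (leq_maxr m i)).
have -> : a *: v + w' = a *: (v + w) + (w' - a *: w).
  by rewrite scalerDr -addrA (addrC w') addNKr.
have [_ PD _] := sP (maxn m i); apply: PD => //.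
apply: (subspace_chain mP (leq_maxl m i)); apply: (stab j mj); split.
  have := subspaceB (sP j) Px (subspace_chain mP _ PwM).
  rewrite geq_max mj ij => /(_ isT).
  by rewrite scalerDr opprD addrACA subrr add0r.
by apply: (subspaceB (And3 W0 WD WZ)) => //; exact: WZ.
Qed.

Lemma finite_span_noetherian (s : seq V) : exists W,
  noetherian [set 1%g] W /\ forall v, v \in s -> W v.
Proof.
elim: s => [|v s [W [nW sW]]].
  exists [set 0]; split => //; split.
  - by split => // [x y -> ->|a x ->]; rewrite ?addr0 ?scaler0.
  - by move=> h x _ ->; rewrite act0.
  - by move=> P sP _ _; exists 0%N => i _ x [_ ->]; case: (sP 0%N).
exists [set x | exists a w, W w /\ x = a *: v + w]; split.
  exact: span_cons_noetherian.
have [[W0 _ _] _ _] := nW.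
move=> x; rewrite inE => /orP[/eqP ->|/sW Wx].
  by exists 1, 0; rewrite scale1r addr0.
by exists 0, x; rewrite scale0r add0r.
Qed.

(* Hall's theorem. *)
Lemma poly_Z_noetherian H (s : seq V) : poly_Z H -> exists W,
  noetherian H W /\ forall v, v \in s -> W v.
Proof.
elim=> [|N g pN [W [nW sW]] nN _]; first exact: finite_span_noetherian.
exists (cyclic_span g W); split.
  by apply: cyclic_span_noetherian => //; exact: poly_Z_subgroup.
by move=> v /sW; exact: sub_cyclic_span.
Qed.

End Noetherian.

(** * Extension of linear functionals *)

Section LinearExtension.
Variables (K : fieldType) (V : lmodType K).

Definition linear_functional (f : V -> K) :=
  (forall x y, f (x + y) = f x + f y) /\ (forall a x, f (a *: x) = a * f x).

(** The graph of a functional defined on a subspace, the last clause being single-valuedness;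
    extension is then inclusion of graphs. *)
Definition partial_functional (R : set (V * K)) :=
  [/\ R (0, 0), forall x a y b, R (x, a) -> R (y, b) -> R (x + y, a + b),
      forall c x a, R (x, a) -> R (c *: x, c * a) & forall a, R (0, a) -> a = 0].

Lemma partial_functional_uniq R x a b : partial_functional R ->
  R (x, a) -> R (x, b) -> a = b.
Proof.
move=> [_ RD RZ R0] Ra /(RZ (-1)) Rb.
by have := RD _ _ _ _ Ra Rb; rewrite scaleN1r mulN1r subrr => /R0/subr0_eq.
Qed.

(** The new vector [x0] is sent to 0. A relation x + c x0 = 0 with c nonzero would put [x0] in the
    old domain. *)
Lemma partial_functional_adjoin R x0 : partial_functional R ->
  ~ (exists a, R (x0, a)) ->
  partial_functional [set p | exists c x, R (x, p.2) /\ p.1 = x + c *: x0].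
Proof.
move=> [R00 RD RZ R0] nx0; split => /=.
- by exists 0, 0; rewrite scale0r addr0.
- move=> _ a _ b [c [x [Rx ->]]] [d [y [Ry ->]]]; exists (c + d), (x + y).
  by split; [exact: RD|rewrite scalerDl addrACA].
- move=> d _ a [c [x [Rx ->]]]; exists (d * c), (d *: x).
  by split; [exact: RZ|rewrite scalerDr scalerA].
- move=> a [c [x [Rx /esym/eqP]]].
  have [->|c0] := eqVneq c 0.
    by rewrite scale0r addr0 => /eqP x0'; apply: R0; rewrite -x0'.
  rewrite addr_eq0 => /eqP xe; exfalso; apply: nx0.
  exists (- c^-1 * a); have := RZ (- c^-1) _ _ Rx.
  by rewrite xe scalerN scaleNr opprK scalerA mulVf // scale1r.
Qed.

Lemma linear_extension R : partial_functional R ->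
  exists2 f, linear_functional f & forall x a, R (x, a) -> f x = a.
Proof.
move=> pR.
(* Zorn's lemma runs over the sets whose union with [R] is a graph, so that the empty chain is
   covered. *)
have [F Fp Ftot|A [pA maxA]] := @Zorn_bigcup _ [set X | partial_functional (X `|` R)].
  have [R00 RD RZ R0] := pR.
  have get p : ((\bigcup_(X in F) X) `|` R) p ->
      R p \/ exists2 X, F X & X p.
    by case=> [[X FX Xp]|Rp]; [right; exists X|left].
  have put X p : F X -> (X `|` R) p -> ((\bigcup_(X in F) X) `|` R) p.
    by move=> FX [Xp|Rp]; [left; exists X|right].
  split; first by right.
  - move=> x a y b /get[Rx|[X FX Xx]] /get[Ry|[Y FY Yy]].
    + by right; exact: RD.
    + have [_ YD _ _] := Fp _ FY; apply: (put Y) => //; apply: YD; by [right|left].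
    + have [_ XD _ _] := Fp _ FX; apply: (put X) => //; apply: XD; by [right|left].
    + have [XY|YX] := Ftot _ _ FX FY.
        have [_ YD _ _] := Fp _ FY.
        by apply: (put Y) => //; apply: YD; left => //; exact: XY.
      have [_ XD _ _] := Fp _ FX.
      by apply: (put X) => //; apply: XD; left => //; exact: YX.
  - move=> c x a /get[Rx|[X FX Xx]]; first by right; exact: RZ.
    by have [_ _ XZ _] := Fp _ FX; apply: (put X) => //; apply: XZ; left.
  - move=> a /get[/R0//|[X FX Xa]].
    by have [_ _ _ X0] := Fp _ FX; apply: X0; left.
have total x : exists a, (A `|` R) (x, a).
  apply: contrapT => nx.
  have pB := partial_functional_adjoin pA nx.
  set B := [set p | _] in pB.
  have sB : A `|` R `<=` B.
    by move=> [y a] ya; exists 0, y; rewrite scale0r addr0.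
  have [A00 _ _ _] := pA.
  apply: (maxA B).
    split; first by move=> p Ap; apply: sB; left.
    move=> BA; apply: nx; exists 0; left; apply: BA; exists 1, 0.
    by rewrite scale1r add0r.
  rewrite /=; suff -> : B `|` R = B by [].
  by apply/seteqP; split => [p [//|Rp]|p]; [apply: sB; right|left].
pose f x := proj1_sig (cid (total x)).
have fP x : (A `|` R) (x, f x) by rewrite /f; case: cid.
have [_ AD AZ _] := pA.
exists f; [split|].
- move=> x y; apply: (partial_functional_uniq pA (fP _)); exact: AD.
- move=> a x; apply: (partial_functional_uniq pA (fP _)); exact: AZ.
- move=> x a Rx; apply: (partial_functional_uniq pA (fP _)); by right.
Qed.

End LinearExtension.

(** * Functionals vanishing on the image of an injective endomorphism *)

Section EssentialImage.
Variables (K : fieldType) (G : groupType) (V : lmodType K).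
Variable rho : linear_action G V.

(** Gathers repeated group elements, as [poly_Z_domain] asks for a duplicate-free list. *)
Lemma sum_collect (U : lmodType K) (s : seq (K * G)) (F : G -> U) :
  \sum_(p <- s) p.1 *: F p.2 =
  \sum_(h <- undup (map snd s)) (\sum_(p <- s | p.2 == h) p.1) *: F h.
Proof.
under [RHS]eq_bigr do rewrite scaler_suml big_mkcond.
rewrite exchange_big /= big_seq [RHS]big_seq; apply: eq_bigr => p ps.
rewrite -big_mkcond /=; under eq_bigl do rewrite eq_sym.
rewrite -big_filter filter_pred1_uniq ?undup_uniq ?big_seq1 // mem_undup.
exact: map_f.
Qed.

Definition orbit_span (H : set G) (m : V) : set V :=
  [set x | exists2 s : seq (K * G), (forall p, p \in s -> H p.2) &
    x = \sum_(p <- s) p.1 *: rho p.2 m].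

Lemma orbit_span_subspace H m : is_subspace (orbit_span H m).
Proof.
split.
- by exists [::] => //; rewrite big_nil.
- move=> _ _ [s sH ->] [t tH ->]; exists (s ++ t); last by rewrite big_cat.
  by move=> p; rewrite mem_cat => /orP[/sH|/tH].
- move=> a _ [s sH ->]; exists [seq (a * p.1, p.2) | p <- s].
    by move=> _ /mapP[p /sH ? ->].
  by rewrite big_map scaler_sumr; apply: eq_bigr => p _; rewrite scalerA.
Qed.

Lemma orbit_span_invariant H m : is_subgroup H ->
  is_invariant rho H (orbit_span H m).
Proof.
move=> [H1 HM HV] h _ Hh [s sH ->]; exists [seq (p.1, (h * p.2)%g) | p <- s].
  by move=> _ /mapP[p /sH Hp ->]; exact: HM.
by rewrite big_map act_sum; apply: eq_bigr => p _; rewrite actZ actM.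
Qed.

Lemma orbit_span_self (H : set G) m : H 1%g -> orbit_span H m m.
Proof.
move=> H1; exists [:: (1, 1%g)]; last by rewrite big_seq1 scale1r act1.
by move=> p; rewrite inE => /eqP ->.
Qed.

Lemma orbit_span_sub H m (M : set V) : is_subspace M -> is_invariant rho H M -> M m ->
  orbit_span H m `<=` M.
Proof.
move=> [M0 MD MZ] iM Mm _ [s sH ->]; rewrite big_seq; elim/big_ind: _ => //.
by move=> p /sH Hp; apply: MZ; exact: iM.
Qed.

(** The map sending x to the sum of f(g^-1 x) g over g in [H] is K[H]-linear and takes [m] to a
    nonzero element of K[H]. As K[H] is a domain, it is injective on K[H] m. *)
Lemma orbit_span_free H m x (f : V -> K) (B : seq G) :
  poly_Z H -> linear_functional f -> f m != 0 ->
  (forall h, H h -> f (rho h m) != 0 -> h \in B) ->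
  orbit_span H m x -> (forall h, H h -> f (rho h x) = 0) -> x = 0.
Proof.
move=> pH [fD fZ] fm fB [s sH xe] fx.
have [H1 HM HV] := poly_Z_subgroup pH.
have f0 : f 0 = 0 by rewrite -(scale0r 0) fZ mul0r.
rewrite xe (sum_collect s (fun h => rho h m)) big_seq big1 // => h hs.
rewrite (_ : (\sum_(p <- s | p.2 == h) p.1) = 0) ?scale0r //.
pose b h := f (rho h^-1%g m).
pose c h := \sum_(p <- s | p.2 == h) p.1.
apply: (@poly_Z_domain G K H b [seq x^-1%g | x <- B] (undup (map snd s)) c) => //.
- move=> k Hk bk; rewrite -(invgK k); apply: map_f; apply: fB => //; exact: HV.
- by exists 1%g; rewrite // /b invg1 act1.
- exact: undup_uniq.
- by move=> k; rewrite mem_undup => /mapP[p /sH ? ->].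
move=> g Hg; have := fx _ (HV _ Hg).
rewrite xe act_sum (big_morph f fD f0).
under eq_bigr do rewrite actZ fZ -actM.
move=> fx0; rewrite -[RHS]fx0.
apply: etrans (esym (sum_collect s (fun k => f (rho (g^-1 * k)%g m) : K^o))).
apply: eq_bigr => k _.
by rewrite /c /b invgM invgK.
Qed.

(* If [f m] is nonzero, the sum of the modules [Phi^i (K[H] m)] is direct
   modulo [N], which contradicts the ascending chain condition. *)
Lemma functional_vanishes H (E M N : set V) (Phi : V -> V) (f : V -> K) :
  poly_Z H -> noetherian rho H E -> M `<=` E ->
  is_subspace M -> is_invariant rho H M ->
  is_subspace N -> is_invariant rho H N -> N `<=` M ->
  (forall x y, Phi (x + y) = Phi x + Phi y) ->
  (forall a x, Phi (a *: x) = a *: Phi x) ->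
  (forall h x, Phi (rho h x) = rho h (Phi x)) ->
  (forall x, M x -> M (Phi x)) -> (forall x, M x -> N (Phi x) -> N x) ->
  linear_functional f -> (forall x, N x -> f x = 0) ->
  (forall x, M x -> f (Phi x) = 0) ->
  (forall x, M x -> exists B : seq G, forall h, H h -> f (rho h x) != 0 -> h \in B) ->
  forall m, M m -> f m = 0.
Proof.
move=> pH [_ _ acc] ME sM iM sN iN NM PhiD PhiZ Phirho PhiM PhiN lf fN fPhi fB m Mm.
apply/eqP; apply/negPn/negP => fm.
have sgH := poly_Z_subgroup pH; have [H1 HM HV] := sgH.
have [M0 MD MZ] := sM; have [N0 ND NZ] := sN.
have [fD fZ] := lf.
have Phi0 : Phi 0 = 0 by rewrite -(scale0r 0) PhiZ !scale0r.
have PhiB x y : Phi (x - y) = Phi x - Phi y.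
  by rewrite -scaleN1r PhiD PhiZ scaleN1r.
pose S := orbit_span H m.
have sS : is_subspace S := orbit_span_subspace H m; have [S0 SD SZ] := sS.
have SM : S `<=` M by exact: orbit_span_sub.
(* [S] meets N + Phi(M) only in 0, because [f] and its translates vanish on [N] and on Phi(M). *)
have S_free x y : S x -> M y -> N (x + Phi y) -> x = 0.
  move=> Sx My Nxy; have [B BP] := fB _ Mm.
  apply: (orbit_span_free pH lf fm BP Sx) => h Hh.
  have := fN _ (iN _ _ Hh Nxy).
  by rewrite actD fD -Phirho (fPhi (rho h y)) ?addr0 //; exact: iM.
(* Up to the images of [N], this is the sum of the first [k] modules Phi^i(S). *)
pose fix P k : set V := if k is l.+1 then
  [set v | exists n x y, [/\ N n, S x, P l y & v = n + x + Phi y]] else N.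
have sP k : is_subspace (P k).
  elim: k => [//|k [P0 PD PZ]]; split => /=.
  - by exists 0, 0, 0; rewrite Phi0 !addr0.
  - move=> _ _ [n [x [y [Nn Sx Py ->]]]] [n' [x' [y' [Nn' Sx' Py' ->]]]].
    exists (n + n'), (x + x'), (y + y').
    by split; [exact: ND|exact: SD|exact: PD|rewrite PhiD addrACA (addrACA n)].
  - move=> a _ [n [x [y [Nn Sx Py ->]]]]; exists (a *: n), (a *: x), (a *: y).
    by split; [exact: NZ|exact: SZ|exact: PZ|rewrite PhiZ !scalerDr].
have iP k : is_invariant rho H (P k).
  elim: k => [//|k IH] h _ Hh [n [x [y [Nn Sx Py ->]]]].
  exists (rho h n), (rho h x), (rho h y).
  split; [exact: iN|exact: orbit_span_invariant|exact: IH|by rewrite Phirho !actD].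
have mP k : P k `<=` P k.+1.
  elim: k => [|k IH] v.
    by move=> Nv; exists v, 0, 0; rewrite Phi0 !addr0.
  by move=> [n [x [y [Nn Sx /IH Py ->]]]]; exists n, x, y.
have NP k : N `<=` P k by exact: (subspace_chain mP (leq0n k)).
have PM k : P k `<=` M.
  elim: k => [//|k IH] v [n [x [y [/NM Mn /SM Mx /IH My ->]]]].
  by apply: (MD); [exact: MD|exact: PhiM].
have MX k : M (iter k Phi m) by elim: k => //= k; exact: PhiM.
have Pm k : P k.+1 (iter k Phi m).
  elim: k => [|k IH].
    by exists 0, m, 0; rewrite Phi0 addr0 add0r; split => //; exact: orbit_span_self.
  by exists 0, 0, (iter k Phi m); rewrite !add0r.
(* In an equality Phi^(k+1)(m) = n + x + Phi(y), [S_free] gives x = 0; injectivity modulo [N] then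
   puts Phi^k(m) in [P k]. *)
have nPm k : ~ P k (iter k Phi m).
  elim: k => [/fN/eqP|k IH [n [x [y [Nn Sx Py /= e]]]]]; first by rewrite (negPf fm).
  have Nk : N (x + Phi (y - iter k Phi m)).
    rewrite PhiB e -(addrA n) (addrA x) opprD addrCA subrr addr0 -scaleN1r.
    exact: NZ.
  have x0 := S_free _ _ Sx (subspaceB sM (PM _ _ Py) (MX k)) Nk.
  apply: IH; have [_ PD _] := sP k.
  rewrite -[iter k Phi m](subrK y) addrC; apply: PD => //; apply: NP.
  apply: PhiN; first exact: subspaceB sM _ (PM _ _ Py).
  by rewrite PhiB e x0 addr0 addrK.
have [k stab] := acc P sP iP mP.
by apply: (nPm k); apply: (stab k.+1 (leqnSn k)); split; [exact: Pm|exact/ME/MX].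
Qed.

End EssentialImage.

(** * The prodiscrete topology through cylinders *)

Section Prodiscrete.
Variables (K : fieldType) (A : vectType K) (G : groupType).

Definition agree (F : seq G) (x : G -> A) : set (G -> A) :=
  [set z | forall g, g \in F -> z g = x g].

Lemma prodiscrete_nbhsP (x : {ptws G -> discrete_topology A}) (B : set (G -> A)) :
  nbhs x B <-> exists F, agree F x `<=` B.
Proof.
split=> [|[F FB]].
  pose cyl : set_system (G -> A) := filter_from setT (agree^~ x).
  have fcyl : Filter cyl.
    apply: filter_from_filter; first by exists [::].
    move=> F F' _ _; exists (F ++ F') => // z zFF'; split => g gF.
      by apply: zFF'; rewrite mem_cat gF.
    by apply: zFF'; rewrite mem_cat gF orbT.
  have cvgx : {ptws, cyl --> (x : {ptws G -> discrete_topology A})}.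
    apply/cvg_sup => g U [V] [[W] oW <-] Wx VU.
    apply: filterS VU _; exists [:: g] => // z /(_ g (mem_head _ _)) zg.
    by rewrite /= zg.
  by move=> /cvgx[F _ FB]; exists F.
have fx : Filter (nbhs x).
  exact: (@nbhs_filter {ptws G -> discrete_topology A}).
apply: filterS FB _; elim: F => [|g F IH].
  by rewrite (_ : agree [::] x = setT) ?eqEsubset //; exact: filterT.
have pg : nbhs x [set z : {ptws G -> discrete_topology A} | z g = x g].
  have := @proj_continuous G (fun=> discrete_topology A) g x [set x g].
  by apply; exact: discrete_set1.
apply: filterS (filterI pg IH) => z [zg zF] h; rewrite inE => /orP[/eqP ->//|].
exact: zF.
Qed.

Lemma prodiscrete_closedP (Sigma : set (G -> A)) : prodiscrete_closed Sigma <->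
  forall x, (forall F, exists2 z, Sigma z & agree F x z) -> Sigma x.
Proof.
split=> [cS x xS|xS x clx].
  apply: cS => B /prodiscrete_nbhsP[F FB].
  by have [z Sz Fz] := xS F; exists z; split => //; exact: FB.
apply: xS => F; have [|z [Sz Fz]] := clx (agree F x); last by exists z.
by apply/prodiscrete_nbhsP; exists F.
Qed.

End Prodiscrete.

(** * Duality between configurations and local functionals *)

Section LocalFunctionals.
Variables (K : fieldType) (A : vectType K) (G : groupType).
Local Notation config := (G -> A).
Local Notation dual := (config -> K^o).
Local Notation dimA := (\dim {:A}).
Local Notation basisA := (vbasis {:A}).
Implicit Types (x y z : config) (n : dual) (F : seq G).

(** The continuous linear functionals to discrete K; by linearity, dependence on [F] alone means
    vanishing wherever [F] sees only 0. *)
Definition local_functional : set dual := [set n | linear_functional n /\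
  exists F, forall x, (forall g, g \in F -> x g = 0) -> n x = 0].

Definition finitely_supported : set config :=
  [set x | exists F : seq G, forall g, g \notin F -> x g = 0].

Definition evaluation (g : G) (i : 'I_dimA) : dual := fun x => coord basisA i (x g).

Definition point (g : G) (i : 'I_dimA) : config :=
  fun h => if h == g then basisA`_i else 0.

Definition restriction F x : config :=
  \sum_(g <- F) \sum_i evaluation g i x *: point g i.

Lemma coordA (a : A) : a = \sum_i coord basisA i a *: basisA`_i.
Proof. exact/coord_vbasis/memvf. Qed.

Lemma restrictionE F x h : uniq F ->
  restriction F x h = if h \in F then x h else 0.
Proof.
move=> uF; rewrite /restriction fct_sumE.
have pE g : (\sum_i evaluation g i x *: point g i) h = if g == h then x h else 0.
  rewrite fct_sumE; have [->|gh] := eqVneq g h.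
    by rewrite [RHS]coordA; apply: eq_bigr => i _; rewrite scalrfctE /point eqxx.
  by rewrite big1 // => i _; rewrite scalrfctE /point eq_sym (negPf gh) scaler0.
under eq_bigr do rewrite pE.
rewrite -big_mkcond -big_filter; case: ifP => hF.
  by rewrite filter_pred1_uniq // big_seq1.
rewrite big_seq big1 // => g; rewrite mem_filter => /andP[/eqP ->].
by rewrite hF.
Qed.

Lemma functional_sum (V : lmodType K) (f : V -> K) I (r : seq I) (F : I -> V) :
  linear_functional f -> f (\sum_(i <- r) F i) = \sum_(i <- r) f (F i).
Proof.
move=> [fD fZ]; apply: (big_morph f fD).
by rewrite -(scale0r 0) fZ mul0r.
Qed.

Lemma functionalB (V : lmodType K) (f : V -> K) (x y : V) :
  linear_functional f -> f (x - y) = f x - f y.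
Proof. by move=> [fD fZ]; rewrite -scaleN1r fD fZ mulN1r. Qed.

Lemma local_functionalE n : local_functional n -> exists2 F : seq G, uniq F &
  n = \sum_(g <- F) \sum_i n (point g i) *: evaluation g i.
Proof.
move=> [ln [F nF]]; exists (undup F); first exact: undup_uniq.
apply/funext => x; rewrite fct_sumE.
have -> : n x = n (restriction (undup F) x).
  apply/eqP; rewrite -subr_eq0 -[X in X == _](functionalB x _ ln); apply/eqP.
  apply: nF => g gF; rewrite -[LHS]/(x g - restriction _ x g).
  by rewrite restrictionE ?undup_uniq // mem_undup gF subrr.
rewrite /restriction (functional_sum _ _ ln); apply: eq_bigr => g _.
rewrite (functional_sum _ _ ln) fct_sumE; apply: eq_bigr => i _.
by have [_ ->] := ln; rewrite scalrfctE mulrC.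
Qed.

Lemma evaluation_local g i : local_functional (evaluation g i).
Proof.
split; first by split => [x y|a x]; rewrite /evaluation ?linearD ?linearZ.
by exists [:: g] => x /(_ g (mem_head _ _)) xg; rewrite /evaluation xg linear0.
Qed.

Lemma evaluation_sep x y : (forall g i, evaluation g i x = evaluation g i y) -> x = y.
Proof.
move=> e; apply/funext => g; rewrite [LHS]coordA [RHS]coordA.
by apply: eq_bigr => i _; rewrite -[coord _ _ _]/(evaluation g i x) e.
Qed.

Lemma local_functional_subspace : is_subspace local_functional.
Proof.
split.
- by split; [split=> [x y|a x]; rewrite ?addr0 ?mulr0|exists [::]].
- move=> n m [[nD nZ] [F nF]] [[mD mZ] [F' mF]]; split.
    split=> [x y|a x]; first by rewrite addrfctE nD mD addrACA.
    by rewrite addrfctE nZ mZ -mulrDr.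
  exists (F ++ F') => x xF; rewrite addrfctE nF ?mF ?addr0 // => g gF; apply: xF.
    by rewrite mem_cat gF orbT.
  by rewrite mem_cat gF.
- move=> a n [[nD nZ] [F nF]]; split.
    split=> [x y|b x]; rewrite scalrfctE ?nD ?nZ ?scalerDr //.
    by rewrite -[LHS]/(a * (b * n x)) mulrCA.
  by exists F => x /nF xF; rewrite scalrfctE xF scaler0.
Qed.

(** Evaluations span the local functionals and their values at a configuration can be prescribed
    freely. So A^G is the full dual of the local functionals, which stands in for compactness. *)
Lemma functional_representation (psi : dual -> K) : linear_functional psi ->
  exists x, forall n, local_functional n -> n x = psi n.
Proof.
move=> lpsi; exists (fun g => \sum_i psi (evaluation g i) *: basisA`_i) => n ln.
have [F _ ->] := local_functionalE ln.
rewrite (functional_sum _ _ lpsi) fct_sumE; apply: eq_bigr => g _.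
rewrite (functional_sum _ _ lpsi) fct_sumE; apply: eq_bigr => i _.
rewrite scalrfctE /evaluation coord_sum_free ?(basis_free (vbasisP _)) //.
by have [_ ->] := lpsi.
Qed.

Lemma shift1 x : shift 1%g x = x.
Proof. by apply/funext => g; rewrite /shift invg1 mul1g. Qed.

Lemma shiftM g h x : shift (g * h)%g x = shift g (shift h x).
Proof. by apply/funext => k; rewrite /shift invgM mulgA. Qed.

Definition shift_action : linear_action G config :=
  @LinearAction _ _ config (@shift K A G) (fun _ _ _ => erefl) (fun _ _ _ => erefl)
    shift1 shiftM.

Definition dual_shift (g : G) n : dual := fun x => n (shift g^-1%g x).

Lemma dual_shift1 n : dual_shift 1%g n = n.
Proof. by apply/funext => x; rewrite /dual_shift invg1 shift1. Qed.

Lemma dual_shiftM g h n : dual_shift (g * h)%g n = dual_shift g (dual_shift h n).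
Proof. by apply/funext => x; rewrite /dual_shift invgM shiftM. Qed.

Definition dual_action : linear_action G dual :=
  @LinearAction _ _ dual dual_shift (fun _ _ _ => erefl) (fun _ _ _ => erefl)
    dual_shift1 dual_shiftM.

(** Points at inverses of coset representatives generate: decomposing g^-1 = c h gives g = h^-1
    c^-1, with [H] acting on the left. *)
Lemma finitely_supported_noetherian H : poly_Z H -> index_finite_in setT H ->
  exists2 E, noetherian shift_action H E & finitely_supported `<=` E.
Proof.
move=> pH [s sH]; have [_ _ HV] := poly_Z_subgroup pH.
have [E [nE sE]] := poly_Z_noetherian shift_action
  [seq point c^-1%g i | c <- s, i <- enum 'I_dimA] pH.
exists E => // x [F xF]; have [[_ _ EZ] iE _] := nE.
have -> : x = restriction (undup F) x.
  apply/funext => h; rewrite restrictionE ?undup_uniq // mem_undup.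
  by case: ifPn => // /xF.
apply: subspace_sum => [|g]; first by case: nE.
apply: subspace_sum => [|i]; first by case: nE.
apply: EZ; have [c [h [cs Hh ge]]] := sH g^-1%g I.
have -> : point g i = shift h^-1%g (point c^-1%g i).
  apply/funext => k; rewrite /shift /point -(invgK g) ge invgM invgK.
  by rewrite -(inj_eq (@mulgI _ h)) mulVKg.
apply: (iE _ _ (HV _ Hh)); apply: sE; apply: allpairs_f => //.
by rewrite mem_enum.
Qed.

Lemma local_functional_noetherian H : poly_Z H -> index_finite_in setT H ->
  exists2 E, noetherian dual_action H E & local_functional `<=` E.
Proof.
move=> pH [s sH]; have [_ _ HV] := poly_Z_subgroup pH.
have [E [nE sE]] := poly_Z_noetherian dual_action
  [seq evaluation c^-1%g i | c <- s, i <- enum 'I_dimA] pH.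
exists E => // n /local_functionalE[F _ ->]; have [[_ _ EZ] iE _] := nE.
apply: subspace_sum => [|g]; first by case: nE.
apply: subspace_sum => [|i]; first by case: nE.
apply: EZ; have [c [h [cs Hh ge]]] := sH g^-1%g I.
have -> : evaluation g i = dual_action h^-1%g (evaluation c^-1%g i).
  apply/funext => x; rewrite /= /dual_shift /evaluation /shift.
  by rewrite invgK -invgM -ge invgK.
apply: (iE _ _ (HV _ Hh)); apply: sE; apply: allpairs_f => //.
by rewrite mem_enum.
Qed.

Definition annihilator (Sigma : set config) : set dual :=
  [set n | local_functional n /\ forall x, Sigma x -> n x = 0].

Lemma local_functional_invariant (H : set G) :
  is_invariant dual_action H local_functional.
Proof.
move=> h n _ [[nD nZ] [F nF]]; split.
  split=> [x y|a x] /=; first by rewrite -nD.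
  by rewrite -nZ.
exists [seq (h * g)%g | g <- F] => x xF; apply: nF => g gF.
by rewrite /shift invgK; apply: xF; exact: map_f.
Qed.

Lemma annihilator_subspace Sigma : is_subspace (annihilator Sigma).
Proof.
have [l0 lD lZ] := local_functional_subspace; split => //.
- move=> n m [ln nS] [lm mS]; split; first exact: lD.
  by move=> x Sx; rewrite addrfctE nS ?mS ?addr0.
- move=> a n [ln nS]; split; first exact: lZ.
  by move=> x Sx; rewrite scalrfctE nS ?scaler0.
Qed.

Lemma annihilator_invariant H Sigma : shift_invariant Sigma ->
  is_invariant dual_action H (annihilator Sigma).
Proof.
move=> iS h n Hh [ln nS]; split; first exact: local_functional_invariant ln.
by move=> x Sx /=; apply: nS; exact: iS.
Qed.

Lemma closed_of_annihilator (N : set dual) : N `<=` local_functional ->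
  prodiscrete_closed [set x | forall n, N n -> n x = 0].
Proof.
move=> Nl; apply/prodiscrete_closedP => x xF n Nn.
have [ln [F nF]] := Nl _ Nn; have [z zN zx] := xF F.
rewrite -(zN n Nn); apply/eqP; rewrite -subr_eq0 -[X in X == _](functionalB x z ln).
by apply/eqP; apply: nF => g gF; rewrite -[LHS]/(x g - z g) zx // subrr.
Qed.

(** A bipolar theorem. If no element of [Sigma] matched [x] on [F], a functional could be 0 on
    [Sigma] and on all configurations vanishing on [F], yet 1 at [x]; it would be local and
    annihilate [Sigma]. *)
Lemma annihilator_closed Sigma x : prodiscrete_closed Sigma ->
  vector_subspace Sigma -> (forall n, annihilator Sigma n -> n x = 0) -> Sigma x.
Proof.
move=> /prodiscrete_closedP cS [S0 SD SZ] xN; apply: cS => F; apply: contrapT => nz.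
pose R : set (config * K) := [set p | exists z w,
  [/\ Sigma z, forall g, g \in F -> w g = 0 & p.1 = z + w + p.2 *: x]].
have pR : partial_functional R.
  split.
  - by exists 0, 0; rewrite scale0r !addr0.
  - move=> _ a _ b [z [w [Sz wF /= ->]]] [z' [w' [Sz' wF' /= ->]]].
    exists (z + z'), (w + w'); split => /=; first exact: SD.
      by move=> g gF; rewrite addrfctE wF ?wF' ?addr0.
    by rewrite scalerDl addrACA (addrACA z).
  - move=> c _ a [z [w [Sz wF /= ->]]]; exists (c *: z), (c *: w).
    split => /=; first exact: SZ.
      by move=> g gF; rewrite scalrfctE wF ?scaler0.
    by rewrite !scalerDr scalerA.
  - move=> a [z [w [Sz wF /= /esym/eqP e]]]; apply/eqP; apply/negPn/negP => a0.
    apply: nz; exists (- a^-1 *: z); first exact: SZ.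
    move=> g gF; move: e; rewrite addr_eq0 => /eqP e.
    have := congr1 (fun u : config => - a^-1 *: u g) e.
    rewrite /= !addrfctE wF // addr0 => e'; rewrite scalrfctE e'.
    by rewrite -[(- _) g]/(- (a *: x g)) scalerN scaleNr opprK scalerA mulVf ?scale1r.
have [f lf fR] := linear_extension pR.
have ann : annihilator Sigma f.
  split; last by move=> z Sz; apply: fR; exists z, 0; rewrite scale0r !addr0.
  split => //; exists F => w wF; apply: fR; exists 0, w.
  by rewrite add0r scale0r addr0.
have : f x = 1 by apply: fR; exists 0, 0; rewrite !add0r scale1r.
by move/eqP; rewrite (xN f ann) eq_sym oner_eq0.
Qed.

End LocalFunctionals.

Arguments local_functional {K A G} _.
Arguments finitely_supported {K A G} _.

(** * Linear cellular automata and images of subshifts *)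

Section CellularAutomata.
Variables (K : fieldType) (A : vectType K) (G : groupType).
Local Notation config := (G -> A).
Local Notation dual := (config -> K^o).
Implicit Types (Sigma Lambda : set config) (T : config -> config) (x y z : config).

(** These properties pass to iterates without composing local rules [mu]. *)
Record equivariant_local_linear T : Prop := EquivariantLocalLinear {
  ellD : forall x y, T (x + y) = T x + T y;
  ellZ : forall a x, T (a *: x) = a *: T x;
  ell_shift : forall g x, T (shift g x) = shift g (T x);
  ell_local : exists M : {fset G}, forall x y g,
    (forall m, m \in M -> x (g * m)%g = y (g * m)%g) -> T x g = T y g }.

Lemma full_linear_CA_ell T : full_linear_CA T -> equivariant_local_linear T.
Proof.
move=> [M [mu muT]]; split.
- by move=> x y; apply/funext => g; rewrite -[RHS]/(T x g + T y g) !muT -linearD.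
- by move=> a x; apply/funext => g; rewrite -[RHS]/(a *: T x g) !muT -linearZ.
- move=> g x; apply/funext => h; rewrite muT -[RHS]/(T x (g^-1 * h)%g) muT.
  congr (mu _).
  by apply/funext => m; rewrite /shift !gnorm.
- exists M => x y g xy; rewrite !muT; congr (mu _); apply/funext => m.
  by rewrite /shift invgK xy //; exact: valP.
Qed.

Lemma ell_iter T k : equivariant_local_linear T -> equivariant_local_linear (iter k T).
Proof.
move=> [TD TZ TS [M TM]]; elim: k => [|k [kD kZ kS [N kN]]].
  split => //; exists [fset 1%g]%fset => x y g /(_ 1%g).
  by rewrite inE eqxx mulg1; apply.
split=> /=.
- by move=> x y; rewrite kD TD.
- by move=> a x; rewrite kZ TZ.
- by move=> g x; rewrite kS TS.
exists [fset (m * n)%g | m in M, n in N]%fset => x y g xy; apply: TM => m mM.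
by apply: kN => n nN; rewrite -mulgA; apply: xy; exact: in_imfset2.
Qed.

Section OneAutomaton.
Variable T : config -> config.
Hypothesis ellT : equivariant_local_linear T.

Lemma ell0 : T 0 = 0.
Proof. by rewrite -(scale0r 0) (ellZ ellT) !scale0r. Qed.

Lemma ellB x y : T (x - y) = T x - T y.
Proof. by rewrite -scaleN1r (ellD ellT) (ellZ ellT) scaleN1r. Qed.

Lemma local_functional_comp (n : dual) :
  local_functional n -> local_functional (n \o T : dual).
Proof.
move=> [[nD nZ] [F nF]]; split.
  by split => [x y|a x] /=; rewrite ?(ellD ellT) ?(ellZ ellT) ?nD ?nZ.
have [M TM] := ell_local ellT.
exists [seq (g * m)%g | g <- F, m <- (M : seq G)] => x x0 /=; apply: nF => g gF.
rewrite (TM x 0) ?ell0 // => m mM; apply: x0; exact: allpairs_f.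
Qed.

Lemma finitely_supported_image x : finitely_supported x -> finitely_supported (T x).
Proof.
move=> [F xF]; have [M TM] := ell_local ellT.
exists [seq (f * m^-1)%g | f <- F, m <- (M : seq G)] => g gF.
rewrite (TM x 0) ?ell0 // => m mM; apply: xF; apply: contra gF => gmF.
by rewrite -(mulgK m g); exact: allpairs_f.
Qed.

(** The condition on [y] makes n o T + nu -> n y well defined. An extension is represented by some
    [x]: the terms [nu] place [x] in [Sigma], and the evaluations give T x = y. *)
Lemma image_annihilator Sigma y : prodiscrete_closed Sigma -> vector_subspace Sigma ->
  (T @` Sigma) y <->
  forall n : dual, local_functional n -> annihilator Sigma (n \o T) -> n y = 0.
Proof.
move=> cS sS; split=> [[x Sx <-] n ln [_]|yN]; first exact.
have [L0 LD LZ] := @local_functional_subspace K A G.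
have [N0 ND NZ] := annihilator_subspace Sigma.
pose R : set (dual * K) := [set p | exists n nu : dual,
  [/\ local_functional n, annihilator Sigma nu, p.1 = (n \o T) + nu & p.2 = n y]].
have pR : partial_functional R.
  split.
  - by exists 0, 0; split => //=; rewrite addr0.
  - move=> _ _ _ _ [n [nu [ln nun /= -> ->]]] [m [mu [lm mum /= -> ->]]].
    exists (n + m), (nu + mu); split => //=; [exact: LD|exact: ND|].
    by rewrite addrACA.
  - move=> c _ _ [n [nu [ln nun /= -> ->]]]; exists (c *: n), (c *: nu).
    by split => //=; [exact: LZ|exact: NZ|rewrite scalerDr].
  - move=> a [n [nu [ln nun /= /esym/eqP e ->]]]; apply: yN => //.
    move: e; rewrite addr_eq0 => /eqP ->; rewrite -scaleN1r; exact: NZ.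
have [psi lpsi psiR] := linear_extension pR.
have [x xpsi] := functional_representation lpsi.
exists x.
  apply: annihilator_closed => // nu nun.
  rewrite xpsi; last by case: nun.
  by apply: psiR; exists 0, nu; split => //; rewrite -[LHS]add0r.
apply: evaluation_sep => g i; have le := evaluation_local g i.
rewrite -[LHS]/((evaluation g i \o T) x) xpsi; last exact: local_functional_comp.
by apply: psiR; exists (evaluation g i), 0; split => //; rewrite addr0.
Qed.

Lemma image_linear_subshift Sigma : linear_subshift Sigma ->
  linear_subshift (T @` Sigma).
Proof.
move=> [cS iS sS]; have [S0 SD SZ] := sS; split.
- have -> : T @` Sigma = [set y : config | forall n : dual,
      (local_functional `&` [set n : dual | annihilator Sigma (n \o T)]) n -> n y = 0].
    apply/seteqP; split=> y.
      by move=> /(image_annihilator y cS sS) yN n [ln nS]; exact: yN.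
    by move=> yN; apply/(image_annihilator y cS sS) => n ln nS; exact: yN.
  by apply: closed_of_annihilator => n [].
- by move=> g _ [x Sx <-]; exists (shift g x); [exact: iS|exact: ell_shift].
- split; first by exists 0; rewrite ?ell0.
    by move=> _ _ [x Sx <-] [y Sy <-]; exists (x + y); [exact: SD|exact: ellD].
  by move=> a _ [x Sx <-]; exists (a *: x); [exact: SZ|exact: ellZ].
Qed.

Lemma image_strongly_irreducible Sigma : strongly_irreducible Sigma ->
  strongly_irreducible (T @` Sigma).
Proof.
move=> [D SD]; have [M TM] := ell_local ellT.
(* The set M D M^-1: if E avoids F M D M^-1, then E M avoids F M D. *)
exists [fset (md * m^-1)%g | md in [fset (m * d)%g | m in M, d in D], m in M]%fset.
move=> _ _ [x Sx <-] [y Sy <-] E F EF.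
have [|z [Sz zx zy]] := SD x y Sx Sy [fset (e * m)%g | e in E, m in M]%fset
    [fset (f * m)%g | f in F, m in M]%fset.
  apply/eqP; rewrite -fsubset0; apply/fsubsetP => g; rewrite inE => /andP[].
  move=> /imfset2P[/= e eE [m mM ->]].
  move=> /imfset2P[/= _ /imfset2P[/= f fF [m' m'M ->]] [d dD h]].
  have : e \in (E `&` [fset (f * d)%g | f in F, d in
      [fset (md * m^-1)%g | md in [fset (m * d)%g | m in M, d in D], m in M]])%fset.
    rewrite inE eE /=; apply/imfset2P; exists f => //.
    exists (m' * d * m^-1)%g; last by rewrite !mulgA -h mulgK.
    by apply: in_imfset2 => //; exact: in_imfset2.
  by rewrite EF inE.
exists (T z); split; first by exists z.
- by move=> g gE; apply: TM => m mM; apply: zx; exact: in_imfset2.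
- by move=> g gF; apply: TM => m mM; apply: zy; exact: in_imfset2.
Qed.

End OneAutomaton.

(** A functional is prescribed as 0 on the annihilator, evaluation at [y] on functionals living on
    [F], and 0 on those living off [E]. Strong irreducibility, used for finite sets only, makes this
    consistent; the representing configuration is 0 off [E]. *)
Lemma finitely_supported_dense Lambda y (F : seq G) :
  linear_subshift Lambda -> strongly_irreducible Lambda -> Lambda y ->
  exists2 z, (Lambda `&` finitely_supported) z & agree F y z.
Proof.
move=> [cL iL sL] [D LD] Ly; have [L0 _ _] := sL.
have [N0 ND NZ] := annihilator_subspace Lambda.
(* The set F D^-1: [F] is disjoint from F1 D as soon as [F1] avoids it. *)
pose E := [seq (g * d^-1)%g | g <- F, d <- (D : seq G)].
pose vanish (F : seq G) (e : dual) := linear_functional e /\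
  forall x, (forall g, g \in F -> x g = 0) -> e x = 0.
have van0 F' : vanish F' 0.
  by split => //; split=> [? ?|? ?]; rewrite ?addr0 ?mulr0.
have vanD F1 F2 e1 e2 : vanish F1 e1 -> vanish F2 e2 -> vanish (F1 ++ F2) (e1 + e2).
  move=> [[D1 Z1] v1] [[D2 Z2] v2]; split.
    split=> [? ?|? ?]; rewrite addrfctE ?D1 ?D2 ?Z1 ?Z2 ?mulrDr //.
    by rewrite addrACA.
  move=> x x0; rewrite addrfctE v1 ?v2 ?addr0 // => g gF; apply: x0.
    by rewrite mem_cat gF orbT.
  by rewrite mem_cat gF.
have vanS F1 F2 e : {subset F1 <= F2} -> vanish F1 e -> vanish F2 e.
  by move=> F12 [le ve]; split => // x x0; apply: ve => g /F12; exact: x0.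
have vanZ F' c e : vanish F' e -> vanish F' (c *: e).
  move=> [[De Ze] ve]; split.
    split=> [? ?|a ?]; rewrite scalrfctE ?De ?Ze ?scalerDr //.
    by rewrite -[LHS]/(c * (a * _)) mulrCA.
  by move=> x /ve ex; rewrite scalrfctE ex scaler0.
pose R : set (dual * K) := [set p | exists nu e f : dual, exists F' : seq G,
  [/\ annihilator Lambda nu, vanish F e, vanish F' f /\ ~~ has [in E] F',
      p.1 = nu + e + f & p.2 = e y]].
have pR : partial_functional R.
  split.
  - by exists 0, 0, 0, [::]; split => //=; rewrite !addr0.
  - move=> u a v b [n [e [f [F1 [nn ee [ff FE] /= -> ->]]]]].
    move=> [n' [e' [f' [F2 [nn' ee' [ff' FE'] /= -> ->]]]]].
    exists (n + n'), (e + e'), (f + f'), (F1 ++ F2); split => //=.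
    + exact: ND.
    + by apply: vanS (vanD _ _ _ _ ee ee') => g; rewrite mem_cat orbb.
    + by split; [exact: vanD|rewrite has_cat negb_or FE].
    + by rewrite addrACA (addrACA n).
  - move=> c _ _ [n [e [f [F1 [nn ee [ff FE] /= -> ->]]]]].
    exists (c *: n), (c *: e), (c *: f), F1.
    by split => //=; [exact: NZ|exact: vanZ|split => //; exact: vanZ|rewrite !scalerDr].
  - move=> a [n [e [f [F1 [nn ee [ff FE] /= nef ->]]]]].
    have [|z [Lz zF z0]] := LD y 0 Ly L0 [fset g in F]%fset [fset g in F1]%fset.
      apply/eqP; rewrite -fsubset0; apply/fsubsetP => g; rewrite inE => /andP[].
      rewrite !inE /= => gF /imfset2P[/= h]; rewrite !inE /= => hF1 [d dD ge].
      case/hasP: FE; exists h => //; rewrite -(mulgK d h) -ge.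
      exact: allpairs_f.
    have [_ nL] := nn; have [le ve] := ee; have [_ vf] := ff.
    have := congr1 (fun u : dual => u z) nef.
    rewrite /= !addrfctE nL // add0r vf ?addr0 => [ez|g gF1].
      rewrite -[RHS]/((0 : dual) z) ez.
      apply/eqP; rewrite -subr_eq0 -[X in X == _](functionalB y z le); apply/eqP.
      by apply: ve => g gF; rewrite -[LHS]/(y g - z g) zF ?inE // subrr.
    by rewrite z0 // !inE.
have [psi lpsi psiR] := linear_extension pR.
have [z zpsi] := functional_representation lpsi.
have van_ev g i F' : g \in F' -> vanish F' (evaluation g i).
  move=> gF'; have [le _] := evaluation_local (A := A) g i; split => // x /(_ g gF') xg.
  by rewrite /evaluation xg linear0.
have coord_eq (a b : A) :
    (forall i, coord (vbasis {:A}) i a = coord (vbasis {:A}) i b) -> a = b.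
  by move=> e; rewrite [a]coordA [b]coordA; apply: eq_bigr => i _; rewrite e.
exists z; [split|].
- apply: annihilator_closed => // n nn; rewrite zpsi; last by case: nn.
  by apply: psiR; exists n, 0, 0, [::]; split => //=; rewrite !addr0.
- exists E => g gE; apply: coord_eq => i.
  rewrite -[LHS]/(evaluation g i z) zpsi; last exact: evaluation_local.
  rewrite [RHS]linear0; apply: psiR; exists 0, 0, (evaluation g i), [:: g].
  split => //=; last by rewrite !add0r.
  by split; [apply: van_ev; rewrite mem_head|rewrite orbF].
- move=> g gF; apply: coord_eq => i.
  rewrite -[LHS]/(evaluation g i z) zpsi; last exact: evaluation_local.
  apply: psiR; exists 0, (evaluation g i), 0, [::].
  by split => //=; [exact: van_ev|rewrite add0r addr0].
Qed.

(** * The Garden of Eden theorem and stabilization of images *)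

Section GardenOfEden.
Variables (H : set G) (T : config -> config).
Hypotheses (pH : poly_Z H) (iH : index_finite_in setT H).
Hypothesis ellT : equivariant_local_linear T.

(** The translate by [h] must carry a point of [F'] into [F], so [h] lies in F F'^-1. *)
Lemma pairing_finite (n : dual) x : local_functional n -> finitely_supported x ->
  exists B : seq G, forall h, n (shift h x) != 0 -> h \in B.
Proof.
move=> [_ [F nF]] [F' xF']; exists [seq (g * f^-1)%g | g <- F, f <- F'] => h.
apply: contraNT => hB; apply/eqP; apply: nF => g gF; apply: xF'.
apply: contra hB => hg; have -> : h = (g * (h^-1 * g)^-1)%g by rewrite !gnorm.
exact: allpairs_f.
Qed.

(** Composition with [T] is injective on local functionals modulo the annihilator, by surjectivity.
    Evaluation at x - y kills its image since T (x - y) = 0, so by [functional_vanishes] every local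
    functional is 0 at x - y. *)
Lemma moore Sigma : shift_invariant Sigma -> vector_subspace Sigma ->
  Sigma `<=` T @` Sigma -> pre_injective Sigma T.
Proof.
move=> iS [S0 SD SZ] TS x y Sx Sy [F xyF] Txy.
have Sxy : Sigma (x - y) by rewrite -scaleN1r; apply: SD => //; exact: SZ.
have fxy : finitely_supported (x - y).
  by exists F => g gF; rewrite -[LHS]/(x g - y g) xyF // subrr.
have T0 : T (x - y) = 0 by rewrite ellB // Txy subrr.
have [E nE LE] := local_functional_noetherian A pH iH.
suff van (n : dual) : local_functional n -> n (x - y) = 0.
  apply/eqP; rewrite -subr_eq0; apply/eqP; apply: evaluation_sep => g i.
  rewrite van; last exact: evaluation_local.
  by rewrite -[RHS]/(coord _ i (0 : A)) linear0.
apply: (@functional_vanishes K G dual (@dual_action K A G) H E local_functional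
  (annihilator Sigma) (fun n => n \o T) (fun n => n (x - y))) => //.
- exact: local_functional_subspace.
- exact: local_functional_invariant.
- exact: annihilator_subspace.
- exact: annihilator_invariant.
- by move=> m [].
- move=> h m; apply/funext => z; rewrite /= /dual_shift /=.
  by rewrite (ell_shift ellT).
- by move=> m; exact: local_functional_comp.
- move=> m lm [_ mT]; split => // z /TS[w Sw <-]; exact: mT.
- by move=> m [_]; apply.
- move=> m [[mD mZ] _] /=; rewrite T0 -(scale0r 0) mZ mul0r //.
- move=> m lm; have [B mB] := pairing_finite lm fxy.
  (* The dual action shifts by inverses, hence the inverted list. *)
  exists [seq h^-1%g | h <- B] => h Hh /mB hB.
  by rewrite -(invgK h); exact: map_f.
Qed.

(** By [image_annihilator], a functional [n] killing T(Lambda) must vanish at [y], and density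
    replaces [y] by a finitely supported [z]. On such configurations in [Lambda], [T] is injective,
    so [functional_vanishes] applies with N = 0. *)
Lemma myhill Lambda : linear_subshift Lambda -> strongly_irreducible Lambda ->
  set_fun Lambda Lambda T -> pre_injective Lambda T -> Lambda `<=` T @` Lambda.
Proof.
move=> sL irrL TL injT y Ly; have [cL iL vL] := sL; have [L0 LD LZ] := vL.
apply/(image_annihilator ellT y cL vL) => n ln [_ nT].
have [[nD nZ] [F nF]] := ln.
have [z [Lz fz] zy] := finitely_supported_dense F sL irrL Ly.
have -> : n y = n z.
  apply/eqP; rewrite -subr_eq0 -[X in X == _](functionalB y z ln.1); apply/eqP.
  by apply: nF => g gF; rewrite -[LHS]/(y g - z g) zy // subrr.
have [E nE LE] := finitely_supported_noetherian A pH iH.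
have fsub : is_subspace (@finitely_supported K A G).
  split; first by exists [::].
    move=> u v [F1 u1] [F2 v2]; exists (F1 ++ F2) => g.
    by rewrite mem_cat negb_or => /andP[/u1 ug /v2 vg]; rewrite addrfctE ug vg addr0.
  by move=> a u [F1 u1]; exists F1 => g /u1 ug; rewrite scalrfctE ug scaler0.
apply: (@functional_vanishes K G config (@shift_action K A G) H E
  (Lambda `&` finitely_supported) [set 0] T n _ nE) => //.
- by move=> x [_ /LE].
- exact: subspaceI.
- move=> h x _ [Lx [F1 x1]]; split; first exact: iL.
  exists [seq (h * g)%g | g <- F1] => g gF; apply: x1; apply: contra gF => gF.
  by rewrite -(mulVKg h g); exact: map_f.
- by split => // [u v -> ->|a u ->]; rewrite ?addr0 ?scaler0.
- by move=> h x _ ->; exact: act0.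
- move=> _ ->; split => //; by exists [::].
- exact: ellD.
- exact: ellZ.
- exact: ell_shift.
- by move=> x [Lx fx]; split; [exact: TL|exact: finitely_supported_image].
- move=> x [Lx [F1 x1]] Tx; apply: injT => //; last by rewrite ell0.
  by exists [fset g in F1]%fset => g; rewrite !inE => /x1.
- by move=> x ->; rewrite -(scale0r 0) nZ mul0r.
- by move=> x [Lx _]; exact: nT.
- move=> x [_ fx]; have [B nB] := pairing_finite ln fx; exists B => h _; exact: nB.
Qed.

(** The local functionals whose composite with T^k annihilates [Sigma] form an ascending chain of
    submodules; its common kernels are the images. *)
Lemma iterated_image_stabilizes Sigma : linear_subshift Sigma ->
  set_fun Sigma Sigma T ->
  exists m, forall i, iter m T @` Sigma `<=` iter i T @` Sigma.
Proof.
move=> [cS iS vS] TS; have [E [_ _ acc] LE] := local_functional_noetherian A pH iH.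
have TXS k x : Sigma x -> Sigma (iter k T x).
  by move=> Sx; elim: k => //= k; exact: TS.
pose N k : set dual :=
  local_functional `&` [set n : dual | annihilator Sigma (n \o iter k T)].
have [L0 LD LZ] := @local_functional_subspace K A G.
have [N0 ND NZ] := annihilator_subspace Sigma.
have [|||m stab] := acc N.
- move=> k; split.
  + by split.
  + by move=> n n' [ln nS] [ln' nS']; split; [exact: LD|exact: ND nS nS'].
  + by move=> a n [ln nS]; split; [exact: LZ|exact: NZ nS].
- move=> k h n Hh [ln nS]; split; first exact: local_functional_invariant Hh ln.
  have := annihilator_invariant iS Hh nS; rewrite /= /dual_shift /=.
  congr (annihilator _ _); apply/funext => x /=.
  by rewrite (ell_shift (ell_iter k ellT)).
- move=> k n [ln [_ nS]]; split => //; split.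
    by apply: local_functional_comp => //; exact: ell_iter.
  by move=> x Sx; rewrite /= -iterS iterSr; apply: nS; exact: TS.
(* For [i] below [m] the inclusion holds because the images decrease. *)
exists m => i y; have [mi|im] := leqP m i; last first.
  move=> [x Sx <-]; exists (iter (m - i) T x); first exact: TXS.
  by rewrite -iterD subnKC // ltnW.
move=> /(image_annihilator (ell_iter m ellT) y cS vS) yN.
apply/(image_annihilator (ell_iter i ellT) y cS vS) => n ln nS.
by have [] := stab i mi n (conj (conj ln nS) (LE _ ln)); exact: yN.
Qed.

End GardenOfEden.
End CellularAutomata.

(** * The limit set as the largest pre-injective subsystem *)

Theorem corollary1p7 (K : fieldType) (A : vectType K) (G : groupType)
  (Sigma : set (G -> A)) (tau : (G -> A) -> (G -> A))
  (hG : polycyclic_by_finite G)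
  (hSigma : linear_subshift Sigma)
  (hirr : strongly_irreducible Sigma)
  (htau : linear_CA Sigma Sigma tau) :
  let good := fun Lambda : set (G -> A) =>
    [/\ linear_subshift Lambda,
        strongly_irreducible Lambda,
        Lambda `<=` Sigma,
        set_fun Lambda Lambda tau
      & pre_injective Lambda tau] in
  good (limit_set Sigma tau) /\
  forall Lambda : set (G -> A), good Lambda -> Lambda `<=` limit_set Sigma tau.
Proof.
move=> good; have [tauS [T caT tauT]] := htau.
have ellT := full_linear_CA_ell caT.
have [H [pH iH]] := polycyclic_by_finite_poly_Z hG.
have TS : set_fun Sigma Sigma T by move=> x Sx /=; rewrite -tauT //; exact: tauS.
(* [tau] agrees with [T] only on [Sigma], so iterates are compared along orbits staying there. *)
have iterS x k : Sigma x -> Sigma (iter k T x) /\ iter k tau x = iter k T x.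
  move=> Sx; elim: k => [//|k [Sk ek]] /=.
  by rewrite ek tauT //; split => //; exact: TS.
have imgE Lambda k : Lambda `<=` Sigma -> iter k tau @` Lambda = iter k T @` Lambda.
  by move=> LS; apply: eq_imagel => x /LS Sx; have [_ ->] := iterS x k Sx.
have [m stab] := iterated_image_stabilizes pH iH ellT hSigma TS.
have limE : limit_set Sigma tau = iter m T @` Sigma.
  apply/seteqP; split=> y.
    (* [m] may be 0 while the limit set uses positive indices, hence [m.+1]. *)
    move=> /(_ m.+1 isT); rewrite imgE // => -[x Sx <-].
    by exists (T x); [exact: TS|rewrite -iterSr].
  by move=> ym k _; rewrite imgE //; exact: stab.
have limS : limit_set Sigma tau `<=` Sigma.
  by rewrite limE => _ [x Sx <-]; have [] := iterS x m Sx.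
have limT : limit_set Sigma tau `<=` T @` limit_set Sigma tau.
  by rewrite limE => y /(stab m.+1)[x Sx <-]; exists (iter m T x); first exists x.
split.
  have lim_sub : linear_subshift (limit_set Sigma tau).
    by rewrite limE; apply: image_linear_subshift => //; exact: ell_iter.
  split => //.
  - by rewrite limE; apply: image_strongly_irreducible => //; exact: ell_iter.
  - rewrite limE => _ [x Sx <-] /=; have [Sm _] := iterS x m Sx.
    by rewrite tauT //; exists (T x); [exact: TS|rewrite -iterSr].
  - have [_ iL vL] := lim_sub.
    move=> x y Lx Ly xy; rewrite !tauT; try exact: limS.
    exact: (moore pH iH ellT iL vL limT).
move=> Lambda [sL irrL LS tauL injL] x Lx k _.
have LT : Lambda `<=` T @` Lambda.
  apply: (myhill pH iH ellT sL irrL).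
    by move=> z Lz /=; rewrite -tauT; [exact: tauL|exact: LS].
  by move=> u v Lu Lv uv; rewrite -!tauT; try exact: LS; exact: injL.
(* Surjectivity on [Lambda] iterates, so [Lambda] lies in every image of [Sigma]. *)
have {}LT y : Lambda y -> (iter k T @` Lambda) y.
  elim: k => [|k IH] Ly; first by exists y.
  have [z Lz <-] := IH Ly; have [w Lw <-] := LT _ Lz.
  by exists w; rewrite // iterSr.
rewrite imgE //; have [z Lz <-] := LT _ Lx; exists z => //; exact: LS.
Qed.
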